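(* If there is a polynomial-time algorithm solving the problem CMI restricted to acyclic implicational bases, then there is a polynomial-time algorithm solving the problem DUAL restricted to implicational bases in which every premise has size one (i.e., the problem DUAL in distributive lattices).
   Context: All sets are finite. A unit implicational base on $X$ is a set $\Sigma$ of implications $A\to b$, $A\subseteq X$, $b\in X$. A set $S\subseteq X$ is closed in $\Sigma$ if for every $A\to b\in\Sigma$, $A\not\subseteq S$ or $b\in S$; $\mathcal{C}_\Sigma$ is the family of closed sets and $\mathcal{L}_\Sigma=(\mathcal{C}_\Sigma,\subseteq)$ is a lattice. The implication graph of $\Sigma$ has vertex set $X$ and an arc $x\to y$ iff some $A\to y\in\Sigma$ has $x\in A$; $\Sigma$ is acyclic if this graph has no directed cycle. When all premises have size one, $\mathcal{L}_\Sigma$ is distributive (and every distributive lattice arises this way). A set $M$ is meet-irreducible in $\mathcal{C}_\Sigma$ if $M\in\mathcal{C}_\Sigma$, $M\ne X$, and $M=C_1\cap C_2$ with $C_1,C_2\in\mathcal{C}_\Sigma$ implies $C_1=M$ or $C_2=M$; $\mathcal{M}(\mathcal{C}_\Sigma)$ is the set of these. For $\mathcal{B}\subseteq\mathcal{C}_\Sigma$, $\downarrow\mathcal{B}=\{C\in\mathcal{C}_\Sigma: C\subseteq B \text{ for some } B\in\mathcal{B}\}$ and $\uparrow\mathcal{B}=\{C\in\mathcal{C}_\Sigma: B\subseteq C\text{ for some }B\in\mathcal{B}\}$. Problem DUAL: given $X$, $\Sigma$ and two antichains $\mathcal{B}^+,\mathcal{B}^-$ of $\mathcal{L}_\Sigma$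 (the lattice itself is not given), decide whether $\downarrow\mathcal{B}^+\cap\uparrow\mathcal{B}^-=\emptyset$ and $\downarrow\mathcal{B}^+\cup\uparrow\mathcal{B}^-=\mathcal{C}_\Sigma$. Problem CMI: given $X$, an implicational base $\Sigma$ and a family $\mathcal{M}\subseteq 2^X$, decide whether $\mathcal{M}=\mathcal{M}(\mathcal{C}_\Sigma)$. Polynomial time is measured in the input size. *)

(* Defs.v *)
From mathcomp Require Import all_boot.
Set Implicit Arguments. Unset Strict Implicit. Unset Printing Implicit Defensive.

Definition imp (n : nat) := ({set 'I_n} * 'I_n)%type.
Definition base (n : nat) := seq (imp n).

Definition is_closed n (Sigma : base n) (S : {set 'I_n}) : bool :=
  all (fun ab : imp n => ~~ (ab.1 \subset S) || (ab.2 \in S)) Sigma.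

Definition closed_sets n (Sigma : base n) : {set {set 'I_n}} :=
  [set S | is_closed Sigma S].

Definition meet_irr n (Sigma : base n) (M : {set 'I_n}) : bool :=
  [&& is_closed Sigma M, M != setT &
   [forall C1 : {set 'I_n}, forall C2 : {set 'I_n},
     [&& is_closed Sigma C1, is_closed Sigma C2 & M == C1 :&: C2] ==>
       (C1 == M) || (C2 == M)]].

Definition meet_irreducibles n (Sigma : base n) : {set {set 'I_n}} :=
  [set M | meet_irr Sigma M].

Definition imp_arc n (Sigma : base n) : rel 'I_n :=
  fun x y => has (fun ab : imp n => (x \in ab.1) && (ab.2 == y)) Sigma.

Definition acyclic n (Sigma : base n) : Prop :=
  ~ exists x y : 'I_n, imp_arc Sigma x y && connect (imp_arc Sigma) y x.

Definition unit_premises n (Sigma : base n) : bool :=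
  all (fun ab : imp n => #|ab.1| == 1) Sigma.

Definition is_antichain n (Sigma : base n) (B : seq {set 'I_n}) : bool :=
  all (is_closed Sigma) B &&
  all (fun B1 : {set 'I_n} => all (fun B2 : {set 'I_n} => (B1 \subset B2) ==> (B1 == B2)) B) B.

Definition down_set n (Sigma : base n) (B : seq {set 'I_n}) : {set {set 'I_n}} :=
  [set C | is_closed Sigma C && has (fun b : {set 'I_n} => C \subset b) B].

Definition up_set n (Sigma : base n) (B : seq {set 'I_n}) : {set {set 'I_n}} :=
  [set C | is_closed Sigma C && has (fun b : {set 'I_n} => b \subset C) B].

Definition CMI_answer n (Sigma : base n) (Ms : seq {set 'I_n}) : bool :=
  [set M in Ms] == meet_irreducibles Sigma.

Definition DUAL_answer n (Sigma : base n) (Bp Bm : seq {set 'I_n}) : bool :=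
  (down_set Sigma Bp :&: up_set Sigma Bm == set0) &&
  (down_set Sigma Bp :|: up_set Sigma Bm == closed_sets Sigma).

Inductive letter := L0 | L1 | LSep | LEnd.

Definition enc_set n (A : {set 'I_n}) : seq letter :=
  [seq (if i \in A then L1 else L0) | i <- enum 'I_n].

Definition enc_imp n (ab : imp n) : seq letter :=
  enc_set ab.1 ++ enc_set [set ab.2] ++ [:: LSep].

Definition enc_base n (Sigma : base n) : seq letter :=
  flatten (map (@enc_imp n) Sigma).

Definition enc_family n (F : seq {set 'I_n}) : seq letter :=
  flatten [seq enc_set B ++ [:: LSep] | B <- F].

Definition enc_CMI n (Sigma : base n) (Ms : seq {set 'I_n}) : seq letter :=
  nseq n L1 ++ [:: LEnd] ++ enc_base Sigma ++ [:: LEnd] ++ enc_family Ms.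

Definition enc_DUAL n (Sigma : base n) (Bp Bm : seq {set 'I_n}) : seq letter :=
  nseq n L1 ++ [:: LEnd] ++ enc_base Sigma ++ [:: LEnd] ++ enc_family Bp
    ++ [:: LEnd] ++ enc_family Bm.

Inductive move := MLeft | MRight | MStay.

Record TM := {
  tm_state : finType;
  tm_sym : finType;
  tm_blank : tm_sym;
  tm_input : letter -> tm_sym;
  tm_start : tm_state;
  tm_halting : tm_state -> bool;
  tm_accepting : tm_state -> bool;
  tm_delta : tm_state -> tm_sym -> tm_state * tm_sym * move }.

(* configuration: state, left tape (reversed), scanned symbol, right tape;
   the tape is two-way infinite, filled with blanks *)
Definition config (M : TM) :=
  (tm_state M * seq (tm_sym M) * tm_sym M * seq (tm_sym M))%type.

Definition tm_step (M : TM) (c : config M) : config M :=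
  let: (q, l, a, r) := c in
  if @tm_halting M q then c else
  let: (q', b, m) := @tm_delta M q a in
  match m with
  | MStay => (q', l, b, r)
  | MLeft => match l with
             | [::] => (q', [::], @tm_blank M, b :: r)
             | x :: l' => (q', l', x, b :: r)
             end
  | MRight => match r with
              | [::] => (q', b :: l, @tm_blank M, [::])
              | x :: r' => (q', b :: l, x, r')
              end
  end.

Definition tm_init (M : TM) (w : seq letter) : config M :=
  match map (@tm_input M) w with
  | [::] => (@tm_start M, [::], @tm_blank M, [::])
  | x :: r => (@tm_start M, [::], x, r)
  end.

Definition tm_state_of (M : TM) (c : config M) : tm_state M :=
  let: (q, _, _, _) := c in q.

(* M, run on w, has halted within t steps with verdict b
   (halting configurations are fixed points of tm_step) *)
Definition tm_decides_within (M : TM) (w : seq letter) (t : nat) (b : bool) : bool :=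
  let q := tm_state_of (iter t (@tm_step M) (tm_init M w)) in
  @tm_halting M q && (@tm_accepting M q == b).

Definition CMI_acyclic_in_P : Prop :=
  exists (M : TM) (c k : nat),
    forall (n : nat) (Sigma : base n) (Ms : seq {set 'I_n}),
      acyclic Sigma ->
      let w := enc_CMI Sigma Ms in
      tm_decides_within M w (c * (size w) ^ k + c) (CMI_answer Sigma Ms).

Definition DUAL_distributive_in_P : Prop :=
  exists (M : TM) (c k : nat),
    forall (n : nat) (Sigma : base n) (Bp Bm : seq {set 'I_n}),
      unit_premises Sigma -> is_antichain Sigma Bp -> is_antichain Sigma Bm ->
      let w := enc_DUAL Sigma Bp Bm in
      tm_decides_within M w (c * (size w) ^ k + c) (DUAL_answer Sigma Bp Bm).

(* Main.v *)
Require Import Defs.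
From mathcomp Require Import all_boot.
From HB Require Import structures.
From mathcomp Require Import zify.
From Stdlib Require Import FunctionalExtensionality.
Set Implicit Arguments. Unset Strict Implicit. Unset Printing Implicit Defensive.

(* Write reach for reachability in the graph of the unit premises, choose in each
   strongly connected component its least element as representative, and let
   anc y = {x | x reaches y} if y is a representative, anc y = {y} otherwise.
   With one new element z, the base
     Sigma' = {x -> y | x in anc y, x <> y} u {B n reps -> z | B in B^-}
   is acyclic.  Its meet-irreducible sets containing z are the sets
   z u complement (anc y), one for each y; those avoiding z are the maximal closed
   sets of Sigma that contain no member of B^-.  Hence B^+ and B^- are dual iff the
   former sets together with B^+ are all the meet-irreducible sets of Sigma'.

   The reduction runs on a Turing machine whose tape holds one FIFO queue per
   track.  Machines are composed monadically from fragments that push to or pop from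
   one queue, and the reachability relation is obtained by relaxing every
   implication n times.  The tape alphabet also has a slot for the symbols of
   the given CMI machine, which is finally started on the output track. *)

(** The obstacle is that Sigma may have cycles, while only acyclic instances may be handed to the
    algorithm for CMI. Contracting the strongly connected components would change the ground set;
    instead all n elements stay, and nothing is put below a non-representative. An up-set of the
    resulting order has the same representatives as the Sigma-closed set it generates, but may miss
    other elements. With a full premise B, an up-set could avoid B merely by missing a
    non-representative; cutting B down to its representatives removes these spurious sets. The
    element z separates two kinds of closed sets. Those containing z do not depend on B^-, so their
    meet-irreducibles can be listed without knowing the answer; those avoiding z carry the question
    of duality. On the machine side, popped letters are marked and never erased, so no track is ever
    shifted and each queue operation is one sweep. The tracks then grow with the number of
    operations, which a polynomial bound absorbs. *)

Definition letter_code (x : letter) : bool * bool :=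
  match x with
  | L0 => (false, false) | L1 => (true, false)
  | LSep => (false, true) | LEnd => (true, true)
  end.

Definition letter_decode (c : bool * bool) : letter :=
  match c with
  | (false, false) => L0 | (true, false) => L1
  | (false, true) => LSep | (true, true) => LEnd
  end.

Lemma letter_codeK : cancel letter_code letter_decode.
Proof. by case. Qed.

HB.instance Definition _ := Finite.copy letter (can_type letter_codeK).

(* Loop counters: [QN] and [QN2] hold 1^n, [QK] has one letter per implication stored in
   [QS], [QKB] one per set stored in [QB]. *)
Inductive queue := QIn | QN | QN2 | QS | QK | QP | QB | QKB | QE | QF | QV | QW
  | QTA | QTB | QRep | QFam | QOut.

Definition queues := [:: QIn; QN; QN2; QS; QK; QP; QB; QKB; QE; QF; QV; QW;
  QTA; QTB; QRep; QFam; QOut].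

Definition queue_code (i : queue) : nat :=
  match i with
  | QIn => 0 | QN => 1 | QN2 => 2 | QS => 3 | QK => 4 | QP => 5 | QB => 6
  | QKB => 7 | QE => 8 | QF => 9 | QV => 10 | QW => 11 | QTA => 12 | QTB => 13
  | QRep => 14 | QFam => 15 | QOut => 16
  end.

Lemma queue_codeK : pcancel queue_code (nth None (map some queues)).
Proof. by case. Qed.

HB.instance Definition _ := Countable.copy queue (pcan_type queue_codeK).

Lemma queue_enumP : Finite.axiom queues.
Proof. by case. Qed.

HB.instance Definition _ := isFinite.Build queue queue_enumP.

Definition store := queue -> seq letter.
Definition upd (s : store) (i : queue) (q : seq letter) : store :=
  fun j => if j == i then q else s j.

Lemma updE s i q j : upd s i q j = if j == i then q else s j.
Proof. by []. Qed.

Ltac store_eq := apply: functional_extensionality;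
  let j := fresh "j" in move=> j; rewrite /upd; repeat case: (_ =P _) => //=; try congruence.

(** * Machine fragments with exit values, and their sequential and iterative composition *)

Section Fragments.
Context {sym : Type}.

Record frag (E : Type) := Frag {
  fstate : finType;
  fstart : fstate;
  fdelta : fstate -> sym -> (fstate + E) * sym * move }.
Arguments Frag {E fstate}.
Arguments fdelta {E} f q c : simpl never.

Definition ftape := nat -> sym.
Definition write (t : ftape) p b : ftape := fun j => if j == p then b else t j.

Lemma write_id t p : write t p (t p) = t.
Proof. by apply: functional_extensionality => j; rewrite /write; case: eqP => // ->. Qed.

(** No left move is possible from position 0, so a run certifies that the head stays on a half-line.
    Hence natural numbers suffice as positions on a two-way infinite tape. *)
Definition moved (m : move) (p p' : nat) : Prop :=
  match m with MLeft => p = p'.+1 | MRight => p' = p.+1 | MStay => p' = p end.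

Inductive runs E (F : frag E) : fstate F -> ftape -> nat -> nat -> E -> ftape -> nat -> Prop :=
| runs_exit q t p b m e p' :
    fdelta F q (t p) = (inr e, b, m) -> moved m p p' ->
    runs q t p 1 e (write t p b) p'
| runs_step q t p b m q' p' T e t2 p2 :
    fdelta F q (t p) = (inl q', b, m) -> moved m p p' ->
    runs q' (write t p b) p' T e t2 p2 -> runs q t p T.+1 e t2 p2.

Lemma go_right E (F : frag E) q t p d T e t2 p2 :
  (forall j, j < d -> fdelta F q (t (p + j)) = (inl q, t (p + j), MRight)) ->
  runs q t (p + d) T e t2 p2 -> runs q t p (d + T) e t2 p2.
Proof.
elim: d p => [|d IH] p Hd H; first by rewrite addn0 in H.
apply: (@runs_step _ _ _ _ _ (t p) MRight q p.+1) => //.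
  by have := Hd 0; rewrite addn0; apply.
rewrite write_id; apply: IH; last by rewrite addSnnS.
by move=> j Hj; rewrite addSnnS; apply: Hd.
Qed.

Lemma go_left E (F : frag E) q t p T e t2 p2 :
  (forall j, 0 < j <= p -> fdelta F q (t j) = (inl q, t j, MLeft)) ->
  runs q t 0 T e t2 p2 -> runs q t p (p + T) e t2 p2.
Proof.
elim: p => [|p IH] // Hd H.
apply: (@runs_step _ _ _ _ _ (t p.+1) MLeft q p) => //; first by apply: Hd; lia.
by rewrite write_id; apply: IH => // j Hj; apply: Hd; lia.
Qed.

Definition ret E (e : E) : frag E := Frag tt (fun _ c => (inr e, c, MStay)).

(** The exit step of [F] already enters the start state of [G e], so composition costs no extra
    step. The value [e] is remembered in the state, which is why [E] has to be finite. *)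
Definition bind (E : finType) E' (F : frag E) (G : E -> frag E') : frag E' :=
  @Frag _ (fstate F + {e : E & fstate (G e)})%type (inl (fstart F))
    (fun q c => match q with
     | inl q => let: (r, b, m) := fdelta F q c in
        (match r with
         | inl q' => inl (inl q')
         | inr e => inl (inr (Tagged (fun e => fstate (G e)) (fstart (G e))))
         end, b, m)
     | inr (existT e q) => let: (r, b, m) := fdelta (G e) q c in
        (match r with
         | inl q' => inl (inr (Tagged (fun e => fstate (G e)) q'))
         | inr e' => inr e'
         end, b, m)
     end).

Definition loop (E : finType) E' (F : E -> frag (E + E')) (e0 : E) : frag E' :=
  @Frag _ {e : E & fstate (F e)} (Tagged (fun e => fstate (F e)) (fstart (F e0)))
    (fun q c => let: existT e q := q in
       let: (r, b, m) := fdelta (F e) q c in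
        (match r with
         | inl q' => inl (Tagged (fun e => fstate (F e)) q')
         | inr (inl e') => inl (Tagged (fun e => fstate (F e)) (fstart (F e')))
         | inr (inr e') => inr e'
         end, b, m)).

Lemma runs_bind (E : finType) E' (F : frag E) (G : E -> frag E') q t p T1 e t1 p1 T2 e' t2 p2 :
  runs q t p T1 e t1 p1 -> runs (fstart (G e)) t1 p1 T2 e' t2 p2 ->
  runs (F := bind F G) (inl q) t p (T1 + T2) e' t2 p2.
Proof.
move=> H1 H2.
have emb : forall e q t p T e' t2 p2, runs (F := G e) q t p T e' t2 p2 ->
   runs (F := bind F G) (inr (Tagged (fun e => fstate (G e)) q)) t p T e' t2 p2.
  move=> {H1 H2 q t p} {}e q t p T {}e' {}t2 {}p2; elim=> [{}q {}t {}p b m e1 p' Hd Hm | {}q {}t {}p b m q' p' {}T e1 {}t2 {}p2 Hd Hm _ IH].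
    by apply: (runs_exit (m := m)) => //=; rewrite /fdelta /= -/(fdelta (G e) q (t p)) Hd.
  by apply: (runs_step (m := m) _ Hm IH); rewrite /fdelta /= -/(fdelta (G e) q (t p)) Hd.
elim: H1 H2 => [{}q {}t {}p b m e1 p' Hd Hm | {}q {}t {}p b m q' p' T e1 {}t1 {}p1 Hd Hm _ IH] H2.
  apply: (runs_step (m := m) _ Hm (emb _ _ _ _ _ _ _ _ _)); last exact: H2.
  by rewrite /fdelta /= -/(fdelta F q (t p)) Hd.
apply: (runs_step (m := m) _ Hm (IH _)) => //.
by rewrite /fdelta /= -/(fdelta F q (t p)) Hd.
Qed.

Lemma runs_loop_exit (E : finType) E' (F : E -> frag (E + E')) e q t p T e' t' p' :
  runs (F := F e) q t p T (inr e') t' p' ->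
  runs (F := loop F e) (Tagged (fun e => fstate (F e)) q) t p T e' t' p'.
Proof.
move H: (inr e') => r R; elim: R H => [{}q {}t {}p b m e1 {}p' Hd Hm | {}q {}t {}p b m q' {}p' {}T e1 t2 p2 Hd Hm _ IH] H.
  by apply: (runs_exit (m := m)) => //; rewrite /fdelta /= -/(fdelta (F e) q (t p)) Hd -H.
apply: (runs_step (m := m) _ Hm (IH H)).
by rewrite /fdelta /= -/(fdelta (F e) q (t p)) Hd.
Qed.

(** The parameter of [loop] only selects the start state; the transitions agree. This lets the run
    of a later round be appended to that of an earlier one. *)
Lemma runs_loop_start (E : finType) E' (F : E -> frag (E + E')) e e1 q t p T e' t' p' :
  runs (F := loop F e1) q t p T e' t' p' -> runs (F := loop F e) q t p T e' t' p'.
Proof.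
elim=> [{}q {}t {}p b m e2 p2 Hd Hm | {}q {}t {}p b m q' p2 {}T e2 t1 p1 Hd Hm _ IH].
  exact: (runs_exit (F := loop F e) Hd Hm).
exact: (runs_step (F := loop F e) Hd Hm IH).
Qed.

Lemma runs_loop_step (E : finType) E' (F : E -> frag (E + E')) e e1 q t p T t1 p1 T' e' t' p' :
  runs (F := F e) q t p T (inl e1) t1 p1 ->
  runs (fstart (loop F e1)) t1 p1 T' e' t' p' ->
  runs (F := loop F e) (Tagged (fun e => fstate (F e)) q) t p (T + T') e' t' p'.
Proof.
move H: (inl e1) => r R R'; elim: R H R' => [{}q {}t {}p b m e2 p2 Hd Hm | {}q {}t {}p b m q' p2 {}T e2 {}t1 {}p1 Hd Hm _ IH] H R'.
  apply: (runs_step (m := m) _ Hm (runs_loop_start e R')).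
  by rewrite /fdelta /= -/(fdelta (F e) q (t p)) Hd -H.
apply: (runs_step (m := m) _ Hm (IH H R')).
by rewrite /fdelta /= -/(fdelta (F e) q (t p)) Hd.
Qed.

End Fragments.

(** * FIFO queues on the tracks of one tape, with operation counts *)

Section Queues.
Context {S : finType}.

(* [None] is a free square, [Some None] a square whose letter has been popped. *)
Definition track := option (option letter).
(* Home flag of the leftmost square, the queue tracks, and the symbol written by the
   machine for CMI in the last phase, if any. *)
Definition cell := (bool * {ffun queue -> track} * option S)%type.

Definition is_home (c : cell) : bool := c.1.1.
Definition get (c : cell) (i : queue) : track := c.1.2 i.
Definition put (c : cell) (i : queue) (x : track) : cell :=
  (c.1.1, [ffun j => if j == i then x else c.1.2 j], c.2).

Definition enq (i : queue) (a : letter) : frag unit :=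
  @Frag cell _ (option bool) None
    (fun q c => match q with
     | None => (inl (Some true), c, MRight)
     | Some true => if get c i is None
         then (inl (Some false), put c i (Some (Some a)), MLeft)
         else (inl (Some true), c, MRight)
     | Some false => if is_home c then (inr tt, c, MStay)
         else (inl (Some false), c, MLeft)
     end).

(** State [None] leaves the home square, [Some None] skips the popped squares, and [Some (Some x)]
    carries the result [x] back home. *)
Definition deq (i : queue) : frag (option letter) :=
  @Frag cell _ (option (option (option letter))) None
    (fun q c => match q with
     | None => (inl (Some None), c, MRight)
     | Some None => match get c i with
         | None => (inl (Some (Some None)), c, MLeft)
         | Some None => (inl (Some None), c, MRight)
         | Some (Some a) => (inl (Some (Some (Some a))), put c i (Some None), MLeft)
         end
     | Some (Some x) => if is_home c then (inr x, c, MStay)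
         else (inl (Some (Some x)), c, MLeft)
     end).

Definition content m (q : seq letter) : seq track :=
  nseq m (Some None) ++ [seq Some (Some a) | a <- q].

Definition blank : cell := (false, [ffun => None], None).
Definition home : cell := (true, [ffun => None], None).

(** The existential [m] counts the popped letters of a track. It is hidden from the store but
    counted in the bound [B], because sweeps have to cross these squares. *)
Definition holds (B : nat) (s : store) (t : ftape) : Prop :=
  [/\ t 0 = home,
      forall j, is_home (t j.+1) = false /\ (t j.+1).2 = None
    & forall i, exists m, m + size (s i) <= B /\
        forall j, get (t j.+1) i = nth None (content m (s i)) j].

(* [T] counts queue operations; each one is a sweep over at most [B + T] squares and
   back, where [B] bounds the tracks at the start. *)
Definition does E (F : frag E) (s : store) (e : E) (s' : store) (T : nat) : Prop :=
  forall B t, holds B s t -> exists t' T',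
    [/\ T' <= T * (2 * (B + T) + 8), holds (B + T) s' t'
      & runs (fstart F) t 0 T' e t' 0].

Lemma holds_le B B' s t : B <= B' -> holds B s t -> holds B' s t.
Proof.
move=> le [h0 h1 h2]; split=> // i; have [m [lm Hm]] := h2 i.
by exists m; split=> //; apply: leq_trans le.
Qed.

Lemma does_le E (F : frag E) s e s' T T' :
  does F s e s' T -> T <= T' -> does F s e s' T'.
Proof.
move=> H le B t /H [t' [T1 [lT h r]]]; exists t', T1; split=> //; last first.
  by apply: holds_le h; rewrite leq_add2l.
by apply: leq_trans lT _; rewrite leq_mul // leq_add2r leq_mul2l leq_add2l le orbT.
Qed.

Lemma does_ret E (e : E) s : does (ret e) s e s 1.
Proof.
move=> B t h; exists t, 1; split; [lia | by apply: holds_le h; lia |].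
by rewrite -{2}(write_id t 0); apply: runs_exit.
Qed.

(** Operation counts simply add, because [does] charges every operation with the final bound [B + T]
    on the track lengths. *)
Lemma does_bind (E : finType) E' (F : frag E) (G : E -> frag E') s e s1 T1 e' s2 T2 :
  does F s e s1 T1 -> does (G e) s1 e' s2 T2 -> does (bind F G) s e' s2 (T1 + T2).
Proof.
move=> H1 H2 B t /H1 [t1 [T1' [l1 h1 r1]]].
have [t2 [T2' [l2 h2 r2]]] := H2 _ _ h1.
exists t2, (T1' + T2'); split; last exact: runs_bind r1 r2.
- rewrite mulnDl leq_add //.
    by apply: leq_trans l1 _; rewrite leq_mul // leq_add2r leq_mul2l; lia.
  by rewrite addnA.
- by rewrite addnA.
Qed.

Lemma does_loop_exit (E : finType) E' (F : E -> frag (E + E')) e s e' s' T :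
  does (F e) s (inr e') s' T -> does (loop F e) s e' s' T.
Proof.
move=> H B t /H [t' [T' [l h r]]]; exists t', T'; split=> //.
exact: runs_loop_exit r.
Qed.

Lemma does_loop_step (E : finType) E' (F : E -> frag (E + E')) e e1 s e' s1 s' T T' :
  does (F e) s (inl e1) s1 T -> does (loop F e1) s1 e' s' T' ->
  does (loop F e) s e' s' (T + T').
Proof.
move=> H1 H2 B t /H1 [t1 [T1' [l1 h1 r1]]].
have [t2 [T2' [l2 h2 r2]]] := H2 _ _ h1.
exists t2, (T1' + T2'); split; last exact: runs_loop_step r1 r2.
- rewrite mulnDl leq_add //.
    by apply: leq_trans l1 _; rewrite leq_mul // leq_add2r leq_mul2l; lia.
  by rewrite addnA.
- by rewrite addnA.
Qed.

Lemma get_put c i x j : get (put c i x) j = if j == i then x else get c j.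
Proof. by rewrite /get /put /= ffunE. Qed.

Lemma size_content m q : size (content m q) = m + size q.
Proof. by rewrite size_cat size_nseq size_map. Qed.

Lemma content_ne m q j : j < m + size q -> nth None (content m q) j <> None.
Proof.
move=> lj; rewrite nth_cat size_nseq; case: ltnP => lm; first by rewrite nth_nseq lm.
by rewrite (nth_map L0) //; lia.
Qed.

Lemma content_lt m q j : j < m -> nth None (content m q) j = Some None.
Proof. by move=> lj; rewrite nth_cat size_nseq lj nth_nseq lj. Qed.

Lemma holds_write B s t p i x q m :
  holds B s t -> m + size q <= B.+1 ->
  (forall j, (if j == p then x else get (t j.+1) i) = nth None (content m q) j) ->
  holds B.+1 (upd s i q) (write t p.+1 (put (t p.+1) i x)).
Proof.
move=> [h0 h1 h2] lB Hx; split.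
- by rewrite /write.
- by move=> j; rewrite /write eqSS; case: (j =P p) => _ //; apply: h1.
move=> k; rewrite /upd; case: eqP => [->|ne].
  exists m; split=> // j; rewrite -Hx /write eqSS.
  by case: (j =P p) => [_|//]; rewrite get_put eqxx.
have [m' [lm' Hm']] := h2 k; exists m'; split; first by apply: leqW.
move=> j; rewrite -Hm' /write eqSS; case: (j =P p) => [->|//].
by rewrite get_put; case: (k =P i).
Qed.

Lemma does_enq i a s : does (enq i a) s tt (upd s i (rcons (s i) a)) 1.
Proof.
move=> B t h; have [h0 h1 h2] := h; have [m [lm Hm]] := h2 i.
set p := m + size (s i).
pose c := put (t p.+1) i (Some (Some a)).
have h' : holds B.+1 (upd s i (rcons (s i) a)) (write t p.+1 c).
  apply: (holds_write (m := m) h); first by rewrite size_rcons; lia.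
  move=> j; rewrite Hm /content map_rcons -rcons_cat nth_rcons size_content -/p.
  by case: ltngtP => // lj; rewrite nth_default // size_content -/p ltnW.
(* The summands are: leaving the home square, crossing the [p] used squares, writing, returning, and
   the exit step. *)
exists (write t p.+1 c), (1 + (p + (1 + (p + 1)))).
split; [by rewrite -/p in lm; lia | by rewrite addn1 |].
have R1 : runs (F := enq i a) (Some false) (write t p.+1 c) 0 1 tt (write t p.+1 c) 0.
  rewrite -{2}(write_id (write t p.+1 c) 0); apply: (runs_exit (m := MStay)) => //.
  by case: h' => -> *; rewrite /fdelta /=.
have R2 := @go_left _ _ (enq i a) (Some false) (write t p.+1 c) p _ _ _ _ _ R1.
apply: (@runs_step _ _ (enq i a) None t 0 (t 0) MRight (Some true) 1) => //.
rewrite write_id; apply: go_right.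
  move=> j lj; rewrite add1n /fdelta /= Hm.
  by case: (nth _ _ _) (content_ne lj).
apply: (@runs_step _ _ (enq i a) (Some true) t p.+1 c MLeft (Some false) p) => //.
  by rewrite /fdelta /= Hm nth_default // size_content.
apply: R2 => -[//|j] lj; rewrite /fdelta /=.
by case: h' => _ hh _; case: (hh j) => -> _.
Qed.

Lemma does_deq i s : does (deq i) s (ohead (s i)) (upd s i (behead (s i))) 1.
Proof.
move=> B t h; have [h0 h1 h2] := h; have [m [lm Hm]] := h2 i.
(* On an empty queue the first square that is not popped is free and is left as it is. *)
pose c := if ohead (s i) is Some a then put (t m.+1) i (Some None) else t m.+1.
have h' : holds B.+1 (upd s i (behead (s i))) (write t m.+1 c).
  rewrite /c; case Es: (s i) lm Hm => [|a q] lm Hm /=.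
    rewrite write_id -[in X in upd _ _ X]Es.
    suff -> : upd s i (s i) = s by apply: holds_le h.
    by apply: functional_extensionality => j; rewrite /upd; case: eqP => [->|].
  apply: (holds_write (m := m.+1) h); first by rewrite addSnnS; apply: leqW.
  move=> j; rewrite Hm; case: ltngtP => lj.
  - by rewrite !content_lt // ltnW.
  - rewrite /content !nth_cat !size_nseq ltnNge (ltnW lj) /= ltnNge lj /=.
    by case: j lj => // j lj; rewrite subSn.
  - by rewrite lj content_lt.
exists (write t m.+1 c), (1 + (m + (1 + (m + 1)))).
split; [by lia | by rewrite addn1 |].
have R1 : runs (F := deq i) (Some (Some (ohead (s i)))) (write t m.+1 c) 0 1 (ohead (s i)) (write t m.+1 c) 0.
  rewrite -{2}(write_id (write t m.+1 c) 0); apply: (runs_exit (m := MStay)) => //.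
  by case: h' => -> *; rewrite /fdelta /=.
have R2 := @go_left _ _ (deq i) (Some (Some (ohead (s i)))) (write t m.+1 c) m _ _ _ _ _ R1.
apply: (@runs_step _ _ (deq i) None t 0 (t 0) MRight (Some None) 1) => //.
rewrite write_id; apply: go_right.
  by move=> j lj; rewrite add1n /fdelta /= Hm content_lt.
apply: (@runs_step _ _ (deq i) (Some None) t m.+1 c MLeft (Some (Some (ohead (s i)))) m) => //.
  rewrite /fdelta /= Hm /content nth_cat size_nseq ltnn subnn /c.
  by case: (s i).
apply: R2 => -[//|j] lj; rewrite /fdelta /=.
by case: h' => _ hh _; case: (hh j) => -> _.
Qed.

End Queues.

(** * From fragments to a Turing machine, and the handover to the machine for CMI *)

Section Machine.
Context (M : TM).
Let S := tm_sym M.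
Let cell := @cell S.

(** The head starts on the first input letter, so the home square is made from the blank square to
    its left. *)
Definition open_tape : frag unit :=
  @Frag cell _ bool true
    (fun q c => if q then (inl false, c, MLeft)
                else (inr tt, (true, c.1.2, c.2), MStay)).

Definition seek_output : frag unit :=
  @Frag cell _ bool true
    (fun q c => if q then (inl false, c, MRight)
       else if get c QOut is Some None then (inl false, c, MRight)
       else (inr tt, c, MStay)).

(* What the machine for CMI reads: its own symbol if it wrote one, otherwise the
   output track, the used part of which looks blank. *)
Definition view (c : cell) : S :=
  match c.2 with
  | Some x => x
  | None => if get c QOut is Some (Some a) then @tm_input M a else @tm_blank M
  end.

Definition input_cell (a : letter) : cell :=
  (false, [ffun i => if i == QIn then Some (Some a) else None], None).

Definition machine_of (P : @frag cell unit) : TM :=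
  {| tm_state := (fstate P + tm_state M)%type;
     tm_sym := cell;
     tm_blank := blank;
     tm_input := input_cell;
     tm_start := inl (fstart P);
     tm_halting := fun q => if q is inr q then @tm_halting M q else false;
     tm_accepting := fun q => if q is inr q then @tm_accepting M q else false;
     tm_delta := fun q c => match q with
       | inl q => let: (r, b, m) := fdelta q c in
           (if r is inl q' then inl q' else inr (@tm_start M), b, m)
       | inr q => let: (q', b, m) := @tm_delta M q (view c) in
           (inr q', (c.1.1, c.1.2, Some b), m)
       end |}.

(** Both lists are compared by [nth] with default [blank], since a configuration may store any
    number of outer blanks; everything left of position 0 is blank. *)
Definition on_tape (l : seq cell) a r (t : ftape) p : Prop :=
  [/\ forall j, nth blank l j = if j < p then t (p.-1 - j) else blank,
      a = t p & forall j, nth blank r j = t (p.+1 + j)].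

Definition apply_move (m : move) (l : seq cell) b r :=
  match m with
  | MStay => (l, b, r)
  | MLeft => (behead l, head blank l, b :: r)
  | MRight => (b :: l, head blank r, behead r)
  end.

Lemma on_tape_move l a r t p b m p' :
  on_tape l a r t p -> moved m p p' ->
  let: (l', a', r') := apply_move m l b r in on_tape l' a' r' (write t p b) p'.
Proof.
move=> [hl ha hr]; case: m => /= hp.
- split.
  + move=> j; rewrite nth_behead hl hp ltnS; case: ifP => // lj.
    by rewrite /write; case: eqP; [lia | move=> _; congr t; lia].
  + by rewrite -nth0 hl hp /write /= subn0; case: eqP; [lia|].
  + case=> [|j] /=; first by rewrite /write hp addn0 eqxx.
    by rewrite hr /write; case: eqP; [lia | move=> _; congr t; lia].
- split.
  + case=> [|j] /=; first by rewrite hp /write subn0 eqxx.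
    rewrite hl hp ltnS; case: ifP => // lj.
    by rewrite /write; case: eqP; [lia | move=> _; congr t; lia].
  + by rewrite -nth0 hr hp /write; case: eqP; [lia | move=> _; congr t; lia].
  + move=> j; rewrite nth_behead hr /write; case: eqP; [lia | move=> _; congr t; lia].
- split.
  + move=> j; rewrite hl hp; case: ifP => // lj.
    by rewrite /write; case: eqP; [lia|].
  + by rewrite hp /write eqxx.
  + by move=> j; rewrite hr hp /write; case: eqP; [lia|].
Qed.

Lemma machine_frag (P : @frag cell unit) q t p T e t' p' l a r :
  runs q t p T e t' p' -> on_tape l a r t p ->
  exists l' a' r', on_tape l' a' r' t' p' /\
    iter T (@tm_step (machine_of P)) (inl q, l, a, r) = (inr (@tm_start M), l', a', r').
Proof.
move=> R; elim: R l a r => [{}q {}t {}p b m {}e {}p' Hd Hm | {}q {}t {}p b m q' p1 {}T {}e t2 p2 Hd Hm _ IH] l a r H.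
  have := on_tape_move b H Hm; case E: (apply_move m l b r) => [[l' a'] r'] H'.
  exists l', a', r'; split=> //=.
  case: H => _ -> _; rewrite Hd; move: E; clear.
  by case: m => /=; case: l => [|? ?]; case: r => [|? ?] //= [-> -> ->].
have := on_tape_move b H Hm; case E: (apply_move m l b r) => [[l' a'] r'] H'.
have [l2 [a2 [r2 [H2 I2]]]] := IH _ _ _ H'.
exists l2, a2, r2; split=> //; rewrite iterSr -I2; congr iter.
case: H => _ -> _; rewrite /= Hd; move: E; clear.
by case: m => /=; case: l => [|? ?]; case: r => [|? ?] //= [-> -> ->].
Qed.

(** Cells are compared only through [view] and up to trailing blanks: the composed machine keeps the
    home square, popped squares and the other tracks, all of which look blank to [M]. *)
Definition shows (P : @frag cell unit) (c : config (machine_of P)) (c' : config M) : Prop :=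
  let: (q, l, a, r) := c in let: (q', l', a', r') := c' in
  [/\ q = inr q', view a = a',
      forall j, view (nth blank l j) = nth (@tm_blank M) l' j
    & forall j, view (nth blank r j) = nth (@tm_blank M) r' j].

Lemma view_blank : view blank = @tm_blank M.
Proof. by rewrite /view /get /= ffunE. Qed.

Lemma shows_step (P : @frag cell unit) c c' :
  shows c c' -> shows (tm_step c : config (machine_of P)) (tm_step c').
Proof.
case: c c' => [[[q l] a] r] [[[q' l'] a'] r'] /= [-> Ha Hl Hr].
case Eh: (@tm_halting M q') => //.
rewrite Ha; case: (@tm_delta M q' a') => [[q2 b] []] /=.
- case: l Hl => [|x l] Hl; case: l' Hl => [|x' l'] Hl /=;
  have H0 := Hl 0; have Hs j := Hl j.+1; split; rewrite ?view_blank //;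
  try (by move=> [|j] /=; [rewrite /view | apply: Hr]);
  try (by move: H0; rewrite /= ?view_blank);
  by move=> j; have := Hs j; rewrite /= ?nth_nil ?view_blank.
- case: r Hr => [|x r] Hr; case: r' Hr => [|x' r'] Hr /=;
  have H0 := Hr 0; have Hs j := Hr j.+1; split; rewrite ?view_blank //;
  try (by move=> [|j] /=; [rewrite /view | apply: Hl]);
  try (by move: H0; rewrite /= ?view_blank);
  by move=> j; have := Hs j; rewrite /= ?nth_nil ?view_blank.
- by split.
Qed.

Lemma shows_iter (P : @frag cell unit) c c' T :
  shows c c' -> shows (iter T (@tm_step (machine_of P)) c) (iter T (@tm_step M) c').
Proof. by move=> H; elim: T => //= T; apply: shows_step. Qed.

Lemma halted_iter (N : TM) (c : config N) d :
  @tm_halting N (tm_state_of c) -> iter d (@tm_step N) c = c.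
Proof.
move=> H; elim: d => //= d ->; move: H.
by case: c => [[[q l] a] r] /= ->.
Qed.

Lemma decides_leq (N : TM) w b t t' :
  t <= t' -> tm_decides_within N w t b -> tm_decides_within N w t' b.
Proof.
move=> le; rewrite /tm_decides_within -(subnK le) iterD => /= H.
by case/andP: (H) => H1 _; rewrite halted_iter.
Qed.

Definition input_store (w : seq letter) : store := upd (fun=> [::]) QIn w.

Definition input_tape (w : seq letter) : ftape :=
  fun j => if j is j'.+1 then nth blank (map input_cell w) j' else blank.

Lemma holds_input w : holds (size w) (input_store w) (write (input_tape w) 0 (home : cell)).
Proof.
split=> //.
  move=> j; rewrite /write /=; case: (ltnP j (size w)) => lj.
    by rewrite (nth_map L0).
  by rewrite nth_default ?size_map.
move=> i; exists 0; rewrite /input_store /upd; case: eqP => [->|ne]; split=> // j.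
  rewrite /content /= /write /=; case: (ltnP j (size w)) => lj.
    by rewrite !(nth_map L0) // /get /= ffunE eqxx.
  by rewrite !nth_default ?size_map // /get /= ffunE.
rewrite /content /= nth_nil /write /=; case: (ltnP j (size w)) => lj.
  by rewrite (nth_map L0) // /get /= ffunE; case: eqP ne.
by rewrite nth_default ?size_map // /get /= ffunE.
Qed.

(** This bounds the length of the produced instance of CMI, and with it the running time of the
    machine started on it. *)
Lemma output_size (P : @frag cell unit) w e s T i :
  does P (input_store w) e s T -> size (s i) <= size w + T.
Proof.
move=> /(_ _ _ (holds_input w)) [t [T' [_ [_ _ /(_ i) [m [lm _]]] _]]].
exact: leq_trans (leq_addl _ _) lm.
Qed.

(** The time bound adds two steps of [open_tape], the sweeps of [P], at most [size w + T + 2] steps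
    to find the front of the output queue, and the [tM] steps of [M]. *)
Lemma simulate (P : @frag cell unit) w s T tM b t :
  w <> [::] -> does P (input_store w) tt s T ->
  tm_decides_within M (s QOut) tM b ->
  T * (2 * (size w + T) + 8) + (size w + T) + 4 + tM <= t ->
  tm_decides_within
    (machine_of (bind open_tape (fun=> bind P (fun=> seek_output)))) w t b.
Proof.
move=> w0 HP HM le; apply: (decides_leq le).
set N := machine_of _.
have h0 := holds_input w; set f := input_tape w in h0.
have [t1 [T1 [l1 h1 r1]]] := HP _ _ h0.
have [hh1 hc1 hq1] := h1.
have [m [lm hm]] := hq1 QOut.
have R3 : runs (fstart seek_output) t1 0 (1 + (m + 1)) tt t1 m.+1.
  apply: (@runs_step _ _ seek_output true t1 0 (t1 0) MRight false 1) => //.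
  rewrite write_id; apply: go_right.
    by move=> j lj; rewrite add1n /fdelta /= hm content_lt.
  rewrite add1n -{2}(write_id t1 m.+1); apply: (runs_exit (m := MStay)) => //.
  rewrite /fdelta /= hm /content nth_cat size_nseq ltnn subnn.
  by case: (s QOut).
have R1 : runs (fstart open_tape) f 1 2 tt (write f 0 (home : cell)) 0.
  apply: (@runs_step _ _ open_tape true f 1 (f 1) MLeft false 0) => //.
  by rewrite write_id; apply: (runs_exit (m := MStay)).
have R := runs_bind (G := fun=> bind P (fun=> seek_output)) R1
            (runs_bind (G := fun=> seek_output) r1 R3).
have O : on_tape [::] (input_cell (head L0 w)) (map input_cell (behead w)) f 1.
  split; first by case=> [|j] //=; rewrite nth_nil.
    by rewrite /f /input_tape; case: (w) w0.
  by move=> j; rewrite /f /input_tape add2n /=; case: (w) w0.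
have [l' [a' [r' [O' I]]]] := machine_frag R O.
set T0 := (2 + _)%N in I.
have /decides_leq : T0 + tM <= T * (2 * (size w + T) + 8) + (size w + T) + 4 + tM.
  by rewrite leq_add2r /T0; move: l1 lm; move: (T * _); lia.
apply; move: HM; rewrite /tm_decides_within addnC iterD.
have -> : tm_init N w = (inl (fstart (bind open_tape (fun=> bind P (fun=> seek_output)))), [::], input_cell (head L0 w), map input_cell (behead w)).
  by rewrite /tm_init /=; case: (w) w0.
rewrite I.
(* At the handover the head is on square [m.+1], just after the popped part of the output track; all
   squares to its left look blank. *)
have Sh : @shows (bind open_tape (fun=> bind P (fun=> seek_output))) (inr (@tm_start M), l', a', r') (tm_init M (s QOut)).
  case: O' => Hl Ha Hr.
  have viewE j : view (t1 (m.+1 + j)) = nth (@tm_blank M) (map (@tm_input M) (s QOut)) j.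
    rewrite addSn /view (proj2 (hc1 _)) hm /content nth_cat size_nseq ltnNge leq_addr /=.
    rewrite addKn; case: (ltnP j (size (s QOut))) => lj.
      by rewrite !(nth_map L0).
    by rewrite !nth_default // size_map.
  have HL j : view (nth blank l' j) = @tm_blank M.
    rewrite Hl; case: ifP => lj; last by rewrite view_blank.
    case E: (m.+1.-1 - j) => [|k]; first by rewrite hh1 /view /get /= ffunE.
    by rewrite /view (proj2 (hc1 _)) hm content_lt //; lia.
  have Va : view a' = nth (@tm_blank M) (map (@tm_input M) (s QOut)) 0.
    by rewrite Ha -viewE addn0.
  have Vr j : view (nth blank r' j) = nth (@tm_blank M) (map (@tm_input M) (s QOut)) j.+1.
    by rewrite Hr -viewE addSnnS.
  rewrite /tm_init; case: (map _ _) Va Vr => [|y v] Va Vr /=; split=> // j.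
  - by rewrite HL nth_nil.
  - by rewrite Vr !nth_nil.
  - by rewrite HL nth_nil.
have := shows_iter tM Sh.
case: (iter tM _ (tm_init M _)) => [[[q3 l3] a3] r3].
by case: (iter tM _ _) => [[[q4 l4] a4] r4] /= [-> _ _ _].
Qed.

End Machine.

(** * Queue programs: rotation, counted loops, bit vectors, copying and streaming *)

Notation "x <- F ;; G" := (bind F (fun x => G))
  (at level 100, F at next level, G at level 200, right associativity).
Notation "F ;; G" := (bind F (fun=> G))
  (at level 100, G at level 200, right associativity).

Lemma upd_upd s i q q' : upd (upd s i q) i q' = upd s i q'.
Proof. by store_eq. Qed.

Lemma upd_same s i : upd s i (s i) = s.
Proof. by store_eq. Qed.

Definition bit (b : bool) : letter := if b then L1 else L0.

Lemma bitE b : (bit b == L1) = b.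
Proof. by case: b. Qed.

Lemma size_enc n (A : {set 'I_n}) : size (enc_set A) = n.
Proof. by rewrite size_map size_enum_ord. Qed.

Lemma nth_enc n (A : {set 'I_n}) (k : 'I_n) : nth L0 (enc_set A) k = bit (k \in A).
Proof. by rewrite (nth_map k) ?size_enum_ord // nth_ord_enum. Qed.

(** This makes [LEnd] available as the temporary marker that closes a rotation. *)
Lemma end_enc n (A : {set 'I_n}) : LEnd \notin enc_set A.
Proof. by apply/negP => /mapP [i _]; case: ifP. Qed.

Section Programs.
Context {S : finType}.
Notation frag := (@frag (@cell S)).

Lemma does_eq E (F : frag E) s e s' T e1 s1 T1 :
  does F s e s' T -> e = e1 -> s' = s1 -> T <= T1 -> does F s e1 s1 T1.
Proof. by move=> H <- <-; apply: does_le. Qed.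

(* One full rotation of queue [i], delimited by a temporary end marker: [body] sees
   each letter and returns its replacement. *)
Definition sweep (E : finType) i (body : E -> letter -> frag (E * letter)) e0 : frag E :=
  enq i LEnd ;;
  loop (fun e => x <- deq i ;;
    if x is Some a then
      if a == LEnd then ret (inr e) else r <- body e a ;; enq i r.2 ;; ret (inl r.1)
    else ret (inr e)) e0.

(** The invariant has to hold for every content of queue [i], which is in mid-rotation while the
    body runs. Each letter costs a pop, a push and a return besides the body; the final 3 pays for
    pushing and popping the marker and for the exit. *)
Lemma does_sweep (E : finType) i (body : E -> letter -> frag (E * letter)) (w w' : seq letter)
    (J : nat -> E -> store -> Prop) T e0 s :
  LEnd \notin w -> size w' = size w ->
  (forall k e s, k < size w -> J k e s -> exists e' s',
     [/\ does (body e (nth L0 w k)) s (e', nth L0 w' k) s' T, s' i = s i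
       & forall q, J k.+1 e' (upd s' i q)]) ->
  s i = w -> (forall q, J 0 e0 (upd s i q)) ->
  exists e' s', [/\ does (sweep i body e0) s e' s' (size w * (T + 3) + 3),
    J (size w) e' s' & s' i = w'].
Proof.
move=> wE sz Hb si J0.
(* After [k] letters the queue holds the unread letters, the marker, and the [k] replacements; the
   induction is on the number [d] of unread letters. *)
suff H : forall d k e s, d + k = size w -> (forall q, J k e (upd s i q)) ->
    s i = drop k w ++ LEnd :: take k w' -> exists e' s',
    [/\ does (loop (fun e => x <- deq i ;;
    if x is Some a then
      if a == LEnd then ret (inr e) else r <- body e a ;; enq i r.2 ;; ret (inl r.1)
    else ret (inr e)) e) s e' s' (d * (T + 3) + 2), J (size w) e' s' & s' i = w'].
  have [|||e' [s' [H1 H2 H3]]] := H (size w) 0 e0 (upd s i (rcons (s i) LEnd)).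
  - by rewrite addn0.
  - by move=> q; rewrite upd_upd.
  - by rewrite updE eqxx drop0 take0 cats1 si.
  exists e', s'; split=> //.
  by eapply does_le; [eapply does_bind; [exact: does_enq|exact: H1]|lia].
elim=> [|d IH] k e s1 dk Jk s1i.
  exists e, (upd s1 i w'); split=> //; last by rewrite updE eqxx.
    apply: does_loop_exit.
    have := @does_deq S i s1; rewrite s1i drop_oversize ?cat0s //=; last by lia.
    rewrite take_oversize; last by lia.
    move=> Hd; eapply does_le; first eapply does_bind; first exact: Hd.
      rewrite /= ?eqxx; exact: does_ret.
    by lia.
  by rewrite -dk.
have lk : k < size w by lia.
have := @does_deq S i s1; rewrite s1i (drop_nth L0 lk) /= => Hd.
have [e' [s2 [H1 H2 H3]]] := Hb k e _ lk (Jk (drop k.+1 w ++ LEnd :: take k w')).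
have [|||e2 [s3 [K1 K2 K3]]] := IH k.+1 e' (upd s2 i (rcons (s2 i) (nth L0 w' k))).
- by lia.
- by move=> q; rewrite upd_upd.
- by rewrite H2 !updE !eqxx (take_nth L0) ?sz // rcons_cat rcons_cons.
exists e2, s3; split=> //.
have H4 : does (r <- body e (nth L0 w k) ;; enq i r.2 ;; ret (inl r.1 : E + E)%type)
    (upd s1 i (drop k.+1 w ++ LEnd :: take k w')) (inl e')
    (upd s2 i (rcons (s2 i) (nth L0 w' k))) (T + (1 + 1)).
  eapply does_bind; first exact: H1.
  by eapply does_bind; [exact: does_enq|exact: does_ret].
eapply does_le; first (eapply does_loop_step; last exact: K1).
  eapply does_bind; first exact: Hd.
  rewrite ifN; first exact: H4.
  by apply: contra wE => /eqP <-; rewrite mem_nth.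
by lia.
Qed.

Lemma does_sweep_fun (E : finType) i (body : E -> letter -> frag (E * letter)) (w w' : seq letter)
    (e : nat -> E) (st : nat -> store) T :
  LEnd \notin w -> size w' = size w ->
  (forall k q, k < size w -> does (body (e k) (nth L0 w k)) (upd (st k) i q)
      (e k.+1, nth L0 w' k) (upd (st k.+1) i q) T) ->
  does (sweep i body (e 0)) (upd (st 0) i w) (e (size w)) (upd (st (size w)) i w')
    (size w * (T + 3) + 3).
Proof.
move=> wE sz Hb.
have [|||e' [s' [H1 [Ee [q Eq]] H2]]] := @does_sweep E i body w w'
   (fun k e1 s1 => e1 = e k /\ exists q, s1 = upd (st k) i q) T (e 0) (upd (st 0) i w) wE sz.
- move=> k _ _ lk [-> [q ->]]; exists (e k.+1), (upd (st k.+1) i q); split.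
  + exact: Hb.
  + by rewrite !updE eqxx.
  + by move=> q'; split=> //; exists q'; rewrite upd_upd.
- by rewrite updE eqxx.
- by move=> q; split=> //; exists q; rewrite upd_upd.
by move: H1; rewrite Ee Eq; suff -> : q = w' by []; rewrite -H2 Eq updE eqxx.
Qed.

Lemma does_sweep_set (E : finType) i (body : E -> letter -> frag (E * letter)) n
    (A A' : {set 'I_n}) (e : nat -> E) (st : nat -> store) T e0 e1 s s1 :
  (forall (k : 'I_n) q, does (body (e k) (bit (k \in A))) (upd (st k) i q)
      (e k.+1, bit (k \in A')) (upd (st k.+1) i q) T) ->
  e 0 = e0 -> e n = e1 -> upd (st 0) i (enc_set A) = s -> upd (st n) i (enc_set A') = s1 ->
  does (sweep i body e0) s e1 s1 (n * (T + 3) + 3).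
Proof.
move=> H <- <- <- <-.
have := @does_sweep_fun E i body (enc_set A) (enc_set A') e st T (end_enc A).
rewrite !size_enc; apply=> // k q lk.
by have := H (Ordinal lk) q; rewrite -!nth_enc.
Qed.

(** Queue [i] acts as a unary counter that is intact again after the loop, so such loops can be
    nested on different queues. *)
Definition times i (body : frag unit) : frag unit :=
  sweep i (fun _ a => body ;; ret (tt, a)) tt.

Lemma does_times i body (w : seq letter) (J : nat -> store -> Prop) T s :
  LEnd \notin w ->
  (forall k s, k < size w -> J k s -> exists s',
     [/\ does body s tt s' T, s' i = s i & forall q, J k.+1 (upd s' i q)]) ->
  s i = w -> (forall q, J 0 (upd s i q)) ->
  exists s', [/\ does (times i body) s tt s' (size w * (T + 4) + 3),
    J (size w) s' & s' i = w].
Proof.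
move=> wE Hb si J0.
have [|[] [s' [H1 H2 H3]]] := @does_sweep _ i (fun _ a => body ;; ret (tt, a)) w w
   (fun k _ => J k) (T + 1) tt s wE erefl _ si J0.
  move=> k [] s1 lk /(Hb _ _ lk) [s' [H1 H2 H3]]; exists tt, s'; split=> //.
  by eapply does_bind; [exact: H1|exact: does_ret].
exists s'; split=> //; apply: does_le H1 _; rewrite leq_add2r leq_mul2l; lia.
Qed.

(** The letter goes back to the end, so the queue behaves as a circular tape: after a full turn it
    is restored. *)
Definition read j : frag letter :=
  x <- deq j ;; if x is Some a then enq j a ;; ret a else ret L0.

Lemma does_read j s u c :
  s j = rot c u -> c < size u -> does (read j) s (nth L0 u c) (upd s j (rot c.+1 u)) 3.
Proof.
move=> sj lc; have := @does_deq S j s.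
have Er : rot c u = nth L0 u c :: (drop c.+1 u ++ take c u).
  by rewrite /rot (drop_nth L0 lc).
rewrite sj Er /= => H; eapply does_eq; first (eapply does_bind; first exact: H).
- by eapply does_bind; [exact: does_enq|exact: does_ret].
- by [].
- rewrite updE eqxx upd_upd rotS // Er rot1_cons.
  by store_eq.
- by [].
Qed.

Definition zipmap i j (f : bool -> bool -> bool) : frag unit :=
  sweep i (fun _ a => b <- read j ;; ret (tt, bit (f (a == L1) (b == L1)))) tt.

(** Queue [j] may be longer than a bit vector: only the block at the current rotation [c] is
    consumed. In this way single sets are read out of an encoded base or family. *)
Lemma does_zipmap_at i j f s n (A B : {set 'I_n}) u c :
  i != j -> s i = enc_set A -> s j = rot c u -> c + n <= size u ->
  (forall k : 'I_n, nth L0 u (c + k) = bit (k \in B)) ->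
  does (zipmap i j f) s tt
    (upd (upd s j (rot (c + n) u)) i (enc_set [set x | f (x \in A) (x \in B)]))
    (n * 7 + 3).
Proof.
move=> ij si sj lc Hu.
apply: (does_sweep_set (A := A) (A' := [set x | f (x \in A) (x \in B)])
  (e := fun=> tt) (st := fun k => upd s j (rot (c + k) u)) (T := 4)) => //; last first.
  by rewrite addn0 -sj upd_same -si upd_same.
move=> k q; rewrite bitE inE.
have lk : c + k < size u by apply: leq_trans lc; rewrite ltn_add2l.
eapply does_eq; first eapply does_bind; first apply: (does_read (u := u) (c := c + k) _ lk).
- by rewrite !updE eq_sym (negbTE ij) eqxx.
- exact: does_ret.
- by rewrite Hu bitE.
- by rewrite -addnS; move/eqP: ij => ij; store_eq.
- by [].
Qed.

Lemma does_zipmap i j f s n (A B : {set 'I_n}) :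
  i != j -> s i = enc_set A -> s j = enc_set B ->
  does (zipmap i j f) s tt
    (upd s i (enc_set [set x | f (x \in A) (x \in B)])) (n * 7 + 3).
Proof.
move=> ij si sj.
apply: does_eq (does_zipmap_at (A := A) (B := B) (u := enc_set B) (c := 0) f ij si _ _ _) _ _ _ => //.
- by rewrite rot0.
- by rewrite size_enc.
- by move=> k; rewrite nth_enc.
by rewrite add0n rot_oversize ?size_enc // -sj upd_same.
Qed.

Definition meets i j : frag bool :=
  sweep i (fun e a => b <- read j ;; ret (e || (a == L1) && (b == L1), a)) false.

Lemma does_meets i j s n (A B : {set 'I_n}) :
  i != j -> s i = enc_set A -> s j = enc_set B ->
  does (meets i j) s [exists x, (x \in A) && (x \in B)] s (n * 7 + 3).
Proof.
move=> ij si sj.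
apply: (does_sweep_set (A := A) (A' := A)
  (e := fun k => [exists x : 'I_n, [&& x < k, x \in A & x \in B]])
  (st := fun k => upd s j (rot k (enc_set B))) (T := 4)).
- move=> k q; have lk : k < size (enc_set B) by rewrite size_enc.
  eapply does_eq; first eapply does_bind; first apply: (does_read (u := enc_set B) (c := k) _ lk).
  + by rewrite !updE eq_sym (negbTE ij) eqxx.
  + exact: does_ret.
  + rewrite nth_enc !bitE; congr (_, _); apply/orP/existsP.
      case=> [/existsP [x /andP [lx H]]|H]; [exists x|exists k].
        by rewrite H (leq_trans lx).
      by rewrite H ltnSn.
    case=> x /andP []; rewrite ltnS leq_eqVlt => /orP [/eqP/val_inj -> ->|lx H]; first by right.
    by left; apply/existsP; exists x; rewrite lx.
  + by move/eqP: ij => ij; store_eq.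
  + by [].
- by apply/existsP; case.
- by apply: eq_existsb => x; rewrite ltn_ord.
- by rewrite rot0 -sj upd_same -si upd_same.
- by rewrite rot_oversize ?size_enc // -sj upd_same -si upd_same.
Qed.

(** The sweep state carries the previous bit. Applied to a vector with a single 1, this advances an
    index by one. *)
Definition shift i c : frag bool := sweep i (fun e a => ret (a == L1, bit e)) c.

Definition shifted (c : bool) (P : pred nat) (k : nat) : bool :=
  if k is k'.+1 then P k' else c.

Lemma does_shift i c s n (P : pred nat) :
  s i = enc_set [set x : 'I_n | P x] ->
  does (shift i c) s (shifted c P n) (upd s i (enc_set [set x : 'I_n | shifted c P x]))
    (n * 4 + 3).
Proof.
move=> si.
apply: (does_sweep_set (A := [set x : 'I_n | P x]) (A' := [set x : 'I_n | shifted c P x])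
  (e := shifted c P) (st := fun=> s) (T := 1)) => //; last by rewrite -si upd_same.
move=> k q; rewrite !inE bitE; exact: does_ret.
Qed.

Definition print i j : frag unit :=
  sweep i (fun _ a => enq j a ;; ret (tt, a)) tt.

Lemma does_print i j s : i != j -> LEnd \notin s i ->
  does (print i j) s tt (upd s j (s j ++ s i)) (size (s i) * 5 + 3).
Proof.
move=> ij sE.
have := @does_sweep_fun _ i (fun _ a => enq j a ;; ret (tt, a)) (s i) (s i)
  (fun=> tt) (fun k => upd s j (s j ++ take k (s i))) 2 sE erefl.
rewrite take0 cats0 take_size !upd_same => H; apply: does_eq (H _) _ _ _ => // {H}.
  move=> k q lk; eapply does_eq; first by eapply does_bind; [exact: does_enq|exact: does_ret].
  - by [].
  - rewrite !updE eq_sym (negbTE ij) eqxx (take_nth L0 lk) rcons_cat.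
    by move/eqP: ij => ij; store_eq.
  - by [].
by rewrite /upd; apply: functional_extensionality => k; case: (k =P i) => // ->; rewrite (negbTE ij).
Qed.

Fixpoint emit (l : seq (queue * letter)) : frag unit :=
  if l is (j, a) :: l then enq j a ;; emit l else ret tt.

Definition emitted (l : seq (queue * letter)) (s : store) : store :=
  fun j => s j ++ [seq p.2 | p <- l & p.1 == j].

Lemma emitted_cat l l' s : emitted (l ++ l') s = emitted l' (emitted l s).
Proof.
apply: functional_extensionality => j.
by rewrite /emitted filter_cat map_cat catA.
Qed.

Lemma does_emit l s : does (emit l) s tt (emitted l s) (size l + 1).
Proof.
elim: l s => [|[j a] l IH] s /=.
  eapply does_eq; [exact: does_ret|by []| |by []].
  by apply: functional_extensionality => j; rewrite /emitted cats0.
eapply does_eq; [eapply does_bind; [exact: does_enq|exact: IH]| done | | by lia].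
rewrite -cat1s emitted_cat; congr emitted.
apply: functional_extensionality => i; rewrite /emitted /upd /= (eq_sym j).
by case: eqP => [->|_] /=; rewrite ?cats1 ?cats0.
Qed.

Definition stream i (em : letter -> seq (queue * letter)) : frag unit :=
  loop (fun _ => x <- deq i ;;
    if x is Some a then
      if a == LEnd then ret (inr tt) else emit (em a) ;; ret (inl tt)
    else ret (inr tt)) tt.

(** The stream stops at a separator [LEnd], which it consumes, or at the end of the queue. No letter
    may be sent to [i] itself, since that queue is being drained. *)
Lemma does_stream i em c (w rest : seq letter) s :
  LEnd \notin w -> s i = w ++ rest -> (rest == [::]) || (ohead rest == Some LEnd) ->
  (forall a, all (fun p => p.1 != i) (em a)) -> (forall a, size (em a) <= c) ->
  does (stream i em) s tt (upd (emitted (flatten (map em w)) s) i (behead rest))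
    (size w * (c + 3) + 2).
Proof.
move=> wE si rE emi emc; elim: w s wE si => [|a w IH] s wE si.
  apply: does_loop_exit; have := @does_deq S i s; rewrite si /= => H.
  have H2 : does (if ohead rest is Some a then
      if a == LEnd then ret (inr tt) else emit (em a) ;; ret (inl tt)
    else ret (inr tt : unit + unit)) (upd s i (behead rest)) (inr tt) (upd s i (behead rest)) 1.
    case: rest rE {si H} => [|b r] /=; first by move=> _; exact: does_ret.
    by move=> /eqP [->]; rewrite eqxx; exact: does_ret.
  eapply does_eq; [by eapply does_bind; [exact: H|exact: H2]|by []| |by []].
  by congr upd; apply: functional_extensionality => j; rewrite /emitted cats0.
move: wE; rewrite inE negb_or eq_sym => /andP [aE wE].
have emia l : all (fun p : queue * letter => p.1 != i) l -> forall s, emitted l s i = s i.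
  move=> H s1; rewrite /emitted; suff -> : [seq p <- l | p.1 == i] = [::] by rewrite cats0.
  apply/eqP; rewrite -[_ == _]negbK -has_filter; apply/hasPn => p /(allP H); exact.
have := @does_deq S i s; rewrite si /= => H.
set s1 := upd s i (w ++ rest) in H.
have H2 := IH (emitted (em a) s1) wE.
rewrite emia // {1}/s1 updE eqxx in H2.
have H3 : does (if a == LEnd then ret (inr tt) else emit (em a) ;; ret (inl tt : unit + unit))
    s1 (inl tt) (emitted (em a) s1) (size (em a) + 1 + 1).
  by rewrite (negbTE aE); eapply does_bind; [exact: does_emit|exact: does_ret].
eapply does_eq.
- eapply does_loop_step; last exact: (H2 erefl).
  by eapply does_bind; [exact: H|exact: H3].
- by [].
- rewrite emitted_cat; apply: functional_extensionality => j.
  by rewrite /upd /s1 /emitted /upd; case: eqP.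
- by have := emc a; rewrite /=; lia.
Qed.

End Programs.

(** * The acyclic base, its meet-irreducible sets, and correctness of the reduction *)

Section Reduction.
Context {n : nat}.
Context (Sigma : base n).

Definition reach : rel 'I_n := connect (imp_arc Sigma).

Lemma reach_refl x : reach x x.
Proof. exact: connect0. Qed.

Lemma reach_trans : transitive reach.
Proof. exact: connect_trans. Qed.

Definition is_rep (y : 'I_n) : bool :=
  ~~ [exists u : 'I_n, [&& u < y, reach u y & reach y u]].

Definition reps : {set 'I_n} := [set y | is_rep y].

Definition anc (y : 'I_n) : {set 'I_n} :=
  if is_rep y then [set x | reach x y] else [set y].

Definition old (x : 'I_n) : 'I_n.+1 := widen_ord (leqnSn n) x.
Notation z := (@ord_max n).

Definition lift_set (A : {set 'I_n}) : {set 'I_n.+1} := [set old x | x in A].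

Definition arrows_to (y : 'I_n) : base n.+1 :=
  [seq ([set old x], old y) | x <- enum 'I_n & (x \in anc y) && (x != y)].

Definition cmi_base (Bm : seq {set 'I_n}) : base n.+1 :=
  flatten [seq arrows_to y | y <- enum 'I_n] ++
  [seq (lift_set (B :&: reps), z) | B <- Bm].

Definition cmi_family (Bp : seq {set 'I_n}) : seq {set 'I_n.+1} :=
  [seq z |: lift_set (~: anc y) | y <- enum 'I_n] ++ [seq lift_set B | B <- Bp].

Lemma rep_exists b : exists y, [/\ is_rep y, reach y b & reach b y].
Proof.
case: (arg_minnP (P := fun y => reach y b && reach b y) (fun y : 'I_n => y : nat) (i0 := b)).
  by rewrite reach_refl.
move=> y /andP [yb by_] H; exists y; split=> //.
apply/existsP => -[u /and3P [lu uy yu]].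
have := H u; rewrite leqNgt lu.
by rewrite (reach_trans uy yb) (reach_trans by_ yu) => /(_ isT).
Qed.

Lemma rep_inj x y : is_rep x -> is_rep y -> reach x y -> reach y x -> x = y.
Proof.
move=> rx ry xy yx; apply/val_inj; case: (ltngtP x y) => // l.
- by case/existsP: ry; exists x; rewrite l xy yx.
- by case/existsP: rx; exists y; rewrite l xy yx.
Qed.

Lemma anc_refl y : y \in anc y.
Proof. by rewrite /anc; case: ifP; rewrite inE ?eqxx ?reach_refl. Qed.

Lemma anc_trans x y w : x \in anc y -> y \in anc w -> x \in anc w.
Proof.
rewrite /anc; case: ifP => ry; rewrite inE; last by move/eqP=> ->.
move=> xy; case: ifP => rw; rewrite !inE; first exact: reach_trans.
by move/eqP=> E; rewrite E rw in ry.
Qed.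

(** With [anc_refl] and [anc_trans] this makes [x \in anc y] a partial order. On representatives it
    is the order of the components; a non-representative has only itself below it. *)
Lemma anc_anti x y : x \in anc y -> y \in anc x -> x = y.
Proof.
rewrite /anc; case: ifP => ry; rewrite inE; last by move/eqP.
move=> xy; case: ifP => rx; rewrite inE; last by move/eqP.
exact: rep_inj.
Qed.

Lemma anc_proper x y : x \in anc y -> x != y -> #|anc x| < #|anc y|.
Proof.
move=> xy ne; apply: proper_card; apply/properP; split.
  by apply/subsetP => u ux; apply: anc_trans xy.
exists y; first exact: anc_refl.
by apply: contra ne => yx; rewrite (anc_anti xy yx).
Qed.

Lemma old_inj : injective old.
Proof. by move=> x y [] /val_inj. Qed.

Lemma old_neq x : old x != z.
Proof. by apply/eqP => /(congr1 val) /= E; have := ltn_ord x; rewrite E ltnn. Qed.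

Lemma old_lift x A : (old x \in lift_set A) = (x \in A).
Proof. by rewrite mem_imset //; apply: old_inj. Qed.

Lemma z_lift A : z \in lift_set A = false.
Proof. by apply/negP => /imsetP [x _ E]; have := old_neq x; rewrite -E eqxx. Qed.

Lemma oldP (u : 'I_n.+1) : u = z \/ exists x, u = old x.
Proof.
case: (ltngtP u n) => lu; last by left; apply: val_inj.
- by right; exists (Ordinal lu); apply: val_inj.
- by have := ltn_ord u; lia.
Qed.

Definition restrict (T : {set 'I_n.+1}) : {set 'I_n} := [set x | old x \in T].

Lemma restrictE (T : {set 'I_n.+1}) : T = (if z \in T then [set z] else set0) :|: lift_set (restrict T).
Proof.
apply/setP => u; case: (oldP u) => [->|[x ->]].
  by case: ifP => zT; rewrite !inE ?zT ?eqxx ?z_lift.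
by rewrite inE old_lift !inE; case: ifP; rewrite !inE ?(negbTE (old_neq x)).
Qed.

Lemma restrict_lift A : restrict (lift_set A) = A.
Proof. by apply/setP => x; rewrite inE old_lift. Qed.

Lemma restrict_zlift A : restrict (z |: lift_set A) = A.
Proof. by apply/setP => x; rewrite !inE old_lift (negbTE (old_neq x)). Qed.

Lemma set_ext (T T' : {set 'I_n.+1}) : (z \in T) = (z \in T') -> restrict T = restrict T' -> T = T'.
Proof. by move=> E1 E2; rewrite (restrictE T) (restrictE T') E1 E2. Qed.

Definition anc_closed (A : {set 'I_n}) : Prop :=
  forall x y, x \in anc y -> x \in A -> y \in A.

Definition avoids (Bm : seq {set 'I_n}) (A : {set 'I_n}) : Prop :=
  forall B, B \in Bm -> ~~ (B :&: reps \subset A).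

Lemma closedP Bm (T : {set 'I_n.+1}) :
  is_closed (cmi_base Bm) T <->
  anc_closed (restrict T) /\ (z \in T \/ avoids Bm (restrict T)).
Proof.
rewrite /is_closed /cmi_base all_cat; split.
  case/andP => /allP H1 /allP H2; split.
    move=> x y xy; rewrite !inE => xT.
    case: (x =P y) => [<- //|/eqP ne].
    have /H1 /= : ([set old x], old y) \in flatten [seq arrows_to y | y <- enum 'I_n].
      apply/flattenP; exists (arrows_to y); first by rewrite map_f ?mem_enum.
      by apply/mapP; exists x => //; rewrite mem_filter xy ne mem_enum.
    by rewrite sub1set xT.
  case zT: (z \in T); [by left|right] => B BB.
  have /H2 /= : (lift_set (B :&: reps), z) \in [seq (lift_set (B :&: reps), z) | B <- Bm].
    exact: map_f.
  rewrite zT orbF; apply: contra => /subsetP H.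
  by apply/subsetP => u /imsetP [x /H]; rewrite inE => xT ->.
case=> H1 H2; apply/andP; split; apply/allP => -[P b].
  case/flattenP => l /mapP [y _ ->] /mapP [x]; rewrite mem_filter => /andP [/andP [xy _] _] [-> ->] /=.
  by rewrite sub1set -implybE; apply/implyP => xT; have := H1 _ _ xy; rewrite !inE => /(_ xT).
case/mapP => B BB [-> ->] /=; case: H2 => [->|/(_ _ BB)]; first by rewrite orbT.
move=> H; rewrite (contra _ H) // => /subsetP H'; apply/subsetP => x xB.
by rewrite inE; apply: H'; apply: imset_f.
Qed.

Lemma cmi_base_acyclic Bm : acyclic (cmi_base Bm).
Proof.
(* Every arc increases this rank: arcs between old elements by [anc_proper], and arcs into [z]
   because [anc x] has at most [n] elements. *)
pose rank (u : 'I_n.+1) := if insub (val u) is Some x then #|anc x| else n.+1.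
have rank_old x : rank (old x) = #|anc x|.
  by rewrite /rank (valK x : insub (val (old x)) = Some x).
have rank_z : rank z = n.+1 by rewrite /rank /= insubF // ltnn.
have arc_lt u v : imp_arc (cmi_base Bm) u v -> rank u < rank v.
  case/hasP => -[P b]; rewrite mem_cat => /orP [].
    case/flattenP => l /mapP [y _ ->] /mapP [x]; rewrite mem_filter.
    move=> /andP [/andP [xy ne] _] [-> ->] /=; rewrite inE => /andP [/eqP -> /eqP <-].
    by rewrite !rank_old anc_proper.
  case/mapP => B _ [-> ->] /= /andP [/imsetP [x _ ->] /eqP <-].
  by rewrite rank_old rank_z ltnS -[leqRHS]card_ord max_card.
have conn u v : connect (imp_arc (cmi_base Bm)) u v -> rank u <= rank v.
  case/connectP => p; elim: p u => [|w p IH] u /=; first by move=> _ ->.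
  by case/andP => /arc_lt/ltnW l /IH H /H; apply: leq_trans.
by case=> u [v /andP [/arc_lt l /conn]]; rewrite leqNgt l.
Qed.

Lemma anc_compl_closed y : anc_closed (~: anc y).
Proof.
move=> x w xw; rewrite !inE; apply: contra => wy; exact: anc_trans wy.
Qed.

(** Once [z] is present the premises coming from [Bm] impose nothing, so these closed sets are the
    up-sets of a poset. Their meet-irreducibles are the complements of the principal down-sets. *)
Lemma meet_irr_top Bm (T : {set 'I_n.+1}) : z \in T ->
  meet_irr (cmi_base Bm) T <-> exists y, restrict T = ~: anc y.
Proof.
move=> zT; split.
  case/and3P => /closedP [cT _] neT /forallP mT.
  have [y0 y0T] : exists y, y \notin restrict T.
    apply/existsP; apply: contraNT neT; rewrite negb_exists => /forallP H.
    apply/eqP; apply: set_ext; first by rewrite zT inE.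
    by apply/setP => x; have := H x; rewrite negbK => ->; rewrite !inE.
  (* Such a [y] is order-maximal outside [T], so adding it keeps an up-set. Then [T] is the meet of
     [T] with [y] added and of the complement of [anc y]; the first differs from [T], so the second
     is [T]. *)
  case: (arg_maxnP (P := fun y => y \notin restrict T) (fun y => #|anc y|) y0T) => y yT ymax.
  exists y.
  have dj x : x \in restrict T -> x \in ~: anc y.
    by rewrite [in X in _ -> X]inE; apply: contraL => xy; apply: contra yT; apply: cT.
  have := forallP (mT (z |: lift_set (y |: restrict T))) (z |: lift_set (~: anc y)).
  have -> : T == (z |: lift_set (y |: restrict T)) :&: (z |: lift_set (~: anc y)).
    apply/eqP; apply: set_ext; first by rewrite !inE eqxx zT.
    apply/setP => x; rewrite [RHS]inE in_setI !in_setU1 (negbTE (old_neq x)) /= !old_lift.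
    rewrite in_setU1; apply/idP/andP => [xT|[/orP [/eqP ->|//]]].
      by rewrite xT orbT; split=> //; apply: dj.
    by rewrite inE anc_refl.
  rewrite andbT; set C1 := z |: _; set C2 := z |: _.
  have -> : is_closed (cmi_base Bm) C1.
    apply/closedP; rewrite restrict_zlift; split; last by left; rewrite setU11.
    move=> x w xw; rewrite !in_setU1 => /orP [/eqP E|xT]; last by rewrite (cT _ _ xw) ?orbT.
    rewrite E in xw; case: eqP => [//|/eqP ne] /=; apply: contraTT isT => wT.
    by have := ymax _ wT; rewrite /= leqNgt anc_proper // eq_sym.
  have -> : is_closed (cmi_base Bm) C2.
    apply/closedP; rewrite restrict_zlift; split; last by left; rewrite setU11.
    exact: anc_compl_closed.
  case/orP => /eqP E; last by rewrite -E restrict_zlift.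
  by move: yT; rewrite -E restrict_zlift setU11.
case=> y Ey; apply/and3P; split.
- by apply/closedP; rewrite Ey; split; [apply: anc_compl_closed|left].
- apply/eqP => E; have : y \in restrict T by rewrite E !inE.
  by rewrite Ey inE anc_refl.
apply/forallP => C1; apply/forallP => C2; apply/implyP => /and3P [/closedP [c1 _] /closedP [c2 _] /eqP E].
have zC : z \in C1 /\ z \in C2 by apply/andP; rewrite -in_setI -E.
(* An up-set missing [y] misses all of [anc y]. Since [y] is not in the meet, one of the two sets
   misses it and so equals [T]. *)
have eqT (C : {set 'I_n.+1}) : z \in C -> T \subset C -> y \notin restrict C -> anc_closed (restrict C) -> C = T.
  move=> zC' TC yC cC; apply: set_ext; first by rewrite zC' zT.
  rewrite Ey; apply/setP => x; apply/idP/idP => [xC|].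
    by rewrite inE; apply: contra yC => xy; apply: cC xy xC.
  by rewrite -Ey !inE; apply: (subsetP TC).
have [yC|yC] := boolP (y \in restrict C1); apply/orP; [right|left]; apply/eqP; apply: eqT => //.
- by case: zC.
- by rewrite E subsetIr.
- apply/negP => yC2; have : y \in restrict T by move: yC yC2; rewrite E !inE => -> ->.
  by rewrite Ey inE anc_refl.
- by case: zC.
- by rewrite E subsetIl.
Qed.

Definition max_avoiding Bm A : Prop :=
  [/\ anc_closed A, avoids Bm A
    & forall A', anc_closed A' -> avoids Bm A' -> A \subset A' -> A = A'].

(** Adding [z] to [T] always gives a closed set, and [T] is its meet with any larger closed set
    without [z]; irreducibility thus forces maximality. Conversely, if [T] is a meet of two closed
    sets, one of them lacks [z] and equals [T] by maximality. *)
Lemma meet_irr_bottom Bm (T : {set 'I_n.+1}) : z \notin T ->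
  meet_irr (cmi_base Bm) T <-> max_avoiding Bm (restrict T).
Proof.
move=> zT; split.
  case/and3P => /closedP [cT [|aT]]; first by rewrite (negbTE zT).
  move=> _ /forallP mT; split=> // A' cA' aA' sA'.
  have := forallP (mT (lift_set A')) (z |: lift_set (restrict T)).
  have -> : is_closed (cmi_base Bm) (lift_set A').
    by apply/closedP; rewrite restrict_lift; split=> //; right.
  have -> : is_closed (cmi_base Bm) (z |: lift_set (restrict T)).
    by apply/closedP; rewrite restrict_zlift setU11; split=> //; left.
  have -> : T == lift_set A' :&: (z |: lift_set (restrict T)).
    apply/eqP; apply: set_ext; first by rewrite in_setI z_lift (negbTE zT).
    apply/setP => x; rewrite [RHS]inE in_setI in_setU1 (negbTE (old_neq x)) /= !old_lift.
    by apply/idP/andP => [xT|[]//]; split=> //; apply: (subsetP sA').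
  case/orP => /eqP E; first by rewrite -E restrict_lift.
  by move: zT; rewrite -E setU11.
case=> cT aT mT; apply/and3P; split.
- by apply/closedP; split=> //; right.
- by apply: contra zT => /eqP ->; rewrite inE.
apply/forallP => C1; apply/forallP => C2; apply/implyP => /and3P [/closedP [c1 a1] /closedP [c2 a2] /eqP E].
have eqT (C : {set 'I_n.+1}) : z \notin C -> T \subset C -> anc_closed (restrict C) ->
    z \in C \/ avoids Bm (restrict C) -> C = T.
  move=> zC TC cC [|aC]; first by rewrite (negbTE zC).
  apply: set_ext; first by rewrite (negbTE zC) (negbTE zT).
  rewrite (mT (restrict C)) //; apply/subsetP => x; rewrite !inE; exact: (subsetP TC).
have [z1|z1] := boolP (z \in C1); apply/orP; [right|left]; apply/eqP; apply: eqT => //.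
- by apply: contra zT => z2; rewrite E inE z1 z2.
- by rewrite E subsetIr.
- by rewrite E subsetIl.
Qed.

(** By [meet_irr_top] the members containing [z] are always right, so only the comparison of [Bp]
    with the maximal avoiding sets remains. *)
Lemma CMI_reduction Bp Bm :
  CMI_answer (cmi_base Bm) (cmi_family Bp) <-> (forall A, A \in Bp <-> max_avoiding Bm A).
Proof.
have memz A : (z |: lift_set A \in cmi_family Bp) = (A \in [seq ~: anc y | y <- enum 'I_n]).
  rewrite mem_cat; apply/orP/idP => [[/mapP [y _ E]|/mapP [B _ E]]|/mapP [y _ ->]].
  - by apply/mapP; exists y; rewrite ?mem_enum // -(restrict_zlift A) E restrict_zlift.
  - by have := z_lift B; rewrite -E setU11.
  - by left; apply/mapP; exists y; rewrite ?mem_enum.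
have meml A : (lift_set A \in cmi_family Bp) = (A \in Bp).
  rewrite mem_cat; apply/orP/idP => [[/mapP [y _ E]|/mapP [B BB E]]|AB].
  - by have := z_lift A; rewrite E setU11.
  - by rewrite -(restrict_lift A) E restrict_lift.
  - by right; apply: map_f.
rewrite /CMI_answer; split.
  move=> /eqP/setP H A; have := H (lift_set A); rewrite !inE meml => ->.
  by rewrite -{2}(restrict_lift A); apply: meet_irr_bottom; rewrite z_lift.
move=> H; apply/eqP/setP => T; rewrite !inE; apply/idP/idP.
  case/boolP: (z \in T) => zT TF.
    apply/(meet_irr_top _ zT); move: TF.
    rewrite (restrictE T) zT restrict_zlift memz => /mapP [y _ ->]; by exists y.
  by apply/(meet_irr_bottom _ zT); apply/H; move: TF; rewrite {1}(restrictE T) (negbTE zT) set0U meml.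
case/boolP: (z \in T) => zT.
  case/(meet_irr_top _ zT) => y Ey; rewrite (restrictE T) zT memz Ey /=.
  by apply/mapP; exists y; rewrite ?mem_enum.
by move/(meet_irr_bottom _ zT)/H; rewrite {2}(restrictE T) (negbTE zT) set0U meml.
Qed.

Lemma unit_closedP (A : {set 'I_n}) : unit_premises Sigma ->
  is_closed Sigma A <-> (forall x y, reach x y -> x \in A -> y \in A).
Proof.
move=> U; split.
  move=> /allP cA x y /connectP [p]; elim: p x => [|w p IH] x /=; first by move=> _ ->.
  case/andP => /hasP [[P b] ab /= /andP [xP /eqP bw]] pw yE xA.
  apply: IH pw yE _; have /cards1P [v Ev] := allP U _ ab.
  have := cA _ ab; rewrite /= in Ev *; rewrite Ev sub1set bw.
  by move: xP; rewrite Ev inE => /eqP <-; rewrite xA.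
move=> cA; apply/allP => -[P b] ab /=; have /cards1P [v /= Ev] := allP U _ ab.
rewrite Ev sub1set -implybE; apply/implyP; apply: cA; apply: connect1.
by apply/hasP; exists (P, b); rewrite //= Ev inE !eqxx.
Qed.

Definition closure_of (A : {set 'I_n}) : {set 'I_n} := [set y | [exists x in A, reach x y]].

Lemma sub_closure (A : {set 'I_n}) : A \subset closure_of A.
Proof.
by apply/subsetP => x xA; rewrite inE; apply/existsP; exists x; rewrite xA reach_refl.
Qed.

Section Distributive.
Context (U : unit_premises Sigma).

Lemma closure_closed (A : {set 'I_n}) : is_closed Sigma (closure_of A).
Proof.
apply/unit_closedP => // x y xy; rewrite !inE => /existsP [w /andP [wA wx]].
by apply/existsP; exists w; rewrite wA (reach_trans wx xy).
Qed.

Lemma closed_anc (A : {set 'I_n}) : is_closed Sigma A -> anc_closed A.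
Proof.
move=> /unit_closedP -/(_ U) cA x y; rewrite /anc; case: ifP => _; rewrite inE; last by move/eqP=> ->.
exact: cA.
Qed.

(** A representative reached from [A] already lies in [A]. Conversely, each element of the closed
    set [B] is reached from its representative, which is again in [B]. This justifies cutting
    premises down to [reps]. *)
Lemma closure_sub (B A : {set 'I_n}) : is_closed Sigma B -> anc_closed A ->
  (B \subset closure_of A) = (B :&: reps \subset A).
Proof.
move=> /unit_closedP -/(_ U) cB cA; apply/subsetP/subsetP => H x.
  rewrite !inE => /andP [/H]; rewrite inE => /existsP [w /andP [wA wx]] rx.
  by apply: cA wA; rewrite /anc rx inE.
move=> xB; have [y [ry yx xy]] := rep_exists x.
rewrite inE; apply/existsP; exists y; rewrite yx andbT; apply: H.
by rewrite !inE ry andbT; apply: cB xB.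
Qed.

Lemma avoids_closed Bm (A : {set 'I_n}) : all (is_closed Sigma) Bm -> is_closed Sigma A ->
  avoids Bm A <-> (forall B, B \in Bm -> ~~ (B \subset A)).
Proof.
move=> /allP cBm cA; have E : closure_of A = A.
  apply/eqP; rewrite eqEsubset sub_closure andbT; apply/subsetP => y; rewrite inE.
  by case/existsP => x /andP [xA xy]; apply: (proj1 (unit_closedP A U) cA) xy xA.
by split=> H B BB; have := H B BB; rewrite -(closure_sub (cBm _ BB) (closed_anc cA)) E.
Qed.

Lemma avoids_closure Bm (A : {set 'I_n}) : all (is_closed Sigma) Bm -> anc_closed A ->
  avoids Bm A -> forall B, B \in Bm -> ~~ (B \subset closure_of A).
Proof. by move=> /allP cBm cA aA B BB; rewrite (closure_sub (cBm _ BB) cA) aA. Qed.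

(** Duality says that the closed sets above no member of [Bm] are exactly those below a member of
    [Bp]; for an antichain [Bp] this means that [Bp] lists the maximal ones. Maximality among
    up-sets of [anc] gives the same sets, as the closure of an avoiding up-set still contains no
    member of [Bm]. *)
Lemma DUAL_reduction Bp Bm : is_antichain Sigma Bp -> is_antichain Sigma Bm ->
  DUAL_answer Sigma Bp Bm <-> (forall A, A \in Bp <-> max_avoiding Bm A).
Proof.
case/andP => cBp /allP aBp /andP [cBm _].
have notup A : is_closed Sigma A -> (A \in up_set Sigma Bm = false) <-> avoids Bm A.
  move=> cA; rewrite inE cA /=; split.
    move=> /hasPn H; apply/avoids_closed => // B BB; exact: H.
  by move/(avoids_closed cBm cA) => H; apply/hasPn.
rewrite /DUAL_answer; split.
  case/andP => /eqP D /eqP C.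
  have av B : B \in Bp -> avoids Bm B.
    move=> BB; have cB := allP cBp _ BB; apply/(notup _ cB).
    apply/negP => Bu; have : B \in down_set Sigma Bp :&: up_set Sigma Bm.
      by rewrite in_setI Bu andbT inE cB; apply/hasP; exists B.
    by rewrite D inE.
  have dn A : anc_closed A -> avoids Bm A -> exists2 B, B \in Bp & closure_of A \subset B.
    move=> cA aA; have : closure_of A \in closed_sets Sigma by rewrite inE closure_closed.
    rewrite -C in_setU => /orP [|].
      by rewrite inE => /andP [_ /hasP].
    rewrite inE => /andP [_ /hasP [B BB]].
    by rewrite (negbTE (avoids_closure cBm cA aA BB)).
  move=> A; split.
    move=> AB; have cA := allP cBp _ AB; split; [exact: closed_anc|exact: av|].
    move=> A' cA' aA' AA'; have [B BB clB] := dn _ cA' aA'.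
    have sB := subset_trans (sub_closure A') clB.
    (* The antichain condition identifies [A] with the member [B] above [A'], which squeezes [A']
       between them. *)
    have /implyP := allP (aBp _ AB) _ BB; move=> /(_ (subset_trans AA' sB)) /eqP E.
    by apply/eqP; rewrite eqEsubset AA' E sB.
  case=> cA aA mA; have [B BB clB] := dn _ cA aA.
  rewrite (mA B) //; first by apply: closed_anc; apply: allP BB.
    exact: av.
  exact: subset_trans (sub_closure A) clB.
move=> H; apply/andP; split.
  apply/eqP/setP => A; rewrite [RHS]inE; apply/negbTE; rewrite in_setI; apply/negP => /andP [].
  rewrite inE => /andP [cA /hasP [B BB AB]]; rewrite inE cA => /hasP [B' BB' B'A].
  have [cB aB _] := (H B).1 BB.
  have /negP [] := (avoids_closed cBm (allP cBp _ BB)).1 aB _ BB'.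
  exact: subset_trans AB.
apply/eqP/setP => A; rewrite in_setU [RHS]inE; apply/orP/idP.
  by case; rewrite inE => /andP [].
move=> cA; case E : (A \in up_set Sigma Bm); [by right|left].
have /(notup _ cA) aA := E.
(* A boolean form of being an avoiding up-set, so that [A] extends to a maximal one by
   finiteness. *)
pose p (A' : {set 'I_n}) := [forall x, forall y, (x \in anc y) ==> (x \in A') ==> (y \in A')] &&
   all (fun B : {set 'I_n} => ~~ (B :&: reps \subset A')) Bm.
have pP A' : p A' <-> anc_closed A' /\ avoids Bm A'.
  split.
    case/andP => /forallP H1 /allP H2; split=> // x y xy xA.
    by have /forallP /(_ y) := H1 x; rewrite xy xA.
  case=> H1 H2; apply/andP; split; last by apply/allP.
  apply/forallP => x; apply/forallP => y; apply/implyP => xy; apply/implyP; exact: H1 xy.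
have /maxset_exists [A' /maxsetP [/pP [cA' aA'] mA'] sA] : p A.
  by apply/pP; split=> //; apply: closed_anc.
rewrite inE cA; apply/hasP; exists A' => //; apply/H; split=> // A2 c2 a2 s2.
by apply/esym/mA' => //; apply/pP.
Qed.

Lemma reduction_correct Bp Bm : is_antichain Sigma Bp -> is_antichain Sigma Bm ->
  CMI_answer (cmi_base Bm) (cmi_family Bp) = DUAL_answer Sigma Bp Bm.
Proof.
move=> aBp aBm; apply/idP/idP.
  by move/CMI_reduction/(DUAL_reduction aBp aBm).
by move/(DUAL_reduction aBp aBm)/CMI_reduction.
Qed.

End Distributive.
End Reduction.

(** * Reachability by repeated relaxation of all implications *)

Section Relaxation.
Context {n : nat} (src dst : imp n -> {set 'I_n}) (Sigma : base n).

Definition grow (V A B : {set 'I_n}) : {set 'I_n} :=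
  [set x | (x \in V) || [exists u, (u \in V) && (u \in A)] && (x \in B)].

Definition relax_all (s : base n) (V : {set 'I_n}) : {set 'I_n} :=
  foldl (fun V ab => grow V (src ab) (dst ab)) V s.

Definition step_rel : rel 'I_n :=
  fun u v => has (fun ab => (u \in src ab) && (v \in dst ab)) Sigma.

Lemma sub_grow (V A B : {set 'I_n}) : V \subset grow V A B.
Proof. by apply/subsetP => x; rewrite inE => ->. Qed.

Lemma sub_relax s (V : {set 'I_n}) : V \subset relax_all s V.
Proof.
elim: s V => [|ab s IH] V //=; exact: subset_trans (sub_grow _ _ _) (IH _).
Qed.

(** The set is updated in place during a pass, but it only grows, so [u] is still present when the
    implication giving the arc is treated. *)
Lemma relax_step (V : {set 'I_n}) u v : u \in V -> step_rel u v -> v \in relax_all Sigma V.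
Proof.
rewrite /step_rel; elim: Sigma V => [|ab s IH] V //= uV /orP [/andP [us vd]|H].
  apply: (subsetP (sub_relax s _)); rewrite inE vd andbT orbC.
  by apply/orP; left; apply/existsP; exists u; rewrite uV.
by apply: IH H; apply: (subsetP (sub_grow _ _ _)).
Qed.

Lemma relax_sound (P V : {set 'I_n}) :
  (forall u v, step_rel u v -> u \in P -> v \in P) ->
  V \subset P -> relax_all Sigma V \subset P.
Proof.
rewrite /step_rel; elim: Sigma V => [|ab s IH] V //= HP VP; apply: IH.
  by move=> u v H; apply: HP; rewrite H orbT.
apply/subsetP => x; rewrite inE => /orP [|/andP [/existsP [u /andP [uV us]] xd]].
  exact: (subsetP VP).
by apply: (HP u x); [rewrite us xd | apply: (subsetP VP)].
Qed.

(** Each pass advances at least one arc along any path, and a path without repeated vertices has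
    fewer than [n] arcs. The general [src] and [dst] let the same argument serve for descendants and
    ancestors. *)
Lemma relax_connect y :
  iter n (relax_all Sigma) [set y] = [set x | connect step_rel y x].
Proof.
apply/eqP; rewrite eqEsubset; apply/andP; split.
  suff H k : iter k (relax_all Sigma) [set y] \subset [set x | connect step_rel y x] by [].
  elim: k => [|k IH] /=; first by rewrite sub1set inE connect0.
  apply: relax_sound IH => u v uv; rewrite !inE => yu.
  exact: connect_trans yu (connect1 uv).
apply/subsetP => x; rewrite inE => /connectP [p0 pp0 ->].
case/shortenP: pp0 => p pp up _ {p0}.
have lp : size p <= n.
  by apply: ltnW; move/card_uniqP: up => /= <-; rewrite -[leqRHS]card_ord max_card.
suff {lp up} H k : size p <= k -> last y p \in iter k (relax_all Sigma) [set y] by exact: H lp.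
move=> /subnK <-; rewrite iterD.
have mono j (V W : {set 'I_n}) : V \subset W -> V \subset iter j (relax_all Sigma) W.
  by elim: j => //= j IH /IH H; apply: subset_trans H (sub_relax _ _).
apply: (subsetP (mono _ _ _ (subxx _))).
elim/last_ind: p pp => [|p v IH]; first by rewrite /= inE.
rewrite rcons_path last_rcons size_rcons => /andP [/IH H].
exact: relax_step.
Qed.

End Relaxation.

Lemma relax_descendants n (Sigma : base n) y :
  iter n (relax_all fst (fun ab => [set ab.2]) Sigma) [set y] = [set x | reach Sigma y x].
Proof.
rewrite relax_connect; apply/setP => x; rewrite !inE; apply: eq_connect => u v.
by apply: eq_has => ab; rewrite inE eq_sym.
Qed.

Lemma relax_ancestors n (Sigma : base n) y :
  iter n (relax_all (fun ab => [set ab.2]) fst Sigma) [set y] = [set x | reach Sigma x y].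
Proof.
rewrite relax_connect; apply/setP => x; rewrite !inE /reach -[RHS]connect_rev.
apply: eq_connect => u v.
by apply: eq_has => ab; rewrite inE eq_sym andbC.
Qed.

Ltac frame H := let j := fresh "j" in
  move=> j; case: j => // _; match goal with |- _ = _ ?j => exact: (H j isT) end.

(** * The reduction as a queue program, with its effect and cost *)

Section ReductionProgram.
Context {S : finType}.
Notation frag := (@frag (@cell S)).

Definition grow_if (f x y : bool) : bool := x || f && y.

(** The premise and the conclusion of the next implication are copied to [QTA] and [QTB], and the
    extra [read] skips its separator. [QV] then grows against the arcs, [QW] along them. *)
Definition relax : frag unit :=
  zipmap QTA QS (fun _ y => y) ;; zipmap QTB QS (fun _ y => y) ;; _ <- read QS ;;
  f <- meets QV QTB ;; zipmap QV QTA (grow_if f) ;;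
  g <- meets QW QTA ;; zipmap QW QTB (grow_if g).

(** A second copy of n is needed because [QN] is in rotation in the loop over all elements. *)
Definition reach_both : frag unit := times QN2 (times QK relax).

(** The first flag records that position [y] has been passed, the second that an earlier element of
    the same component was met. *)
Definition test_rep : frag bool :=
  r <- sweep QV (fun (e : bool * bool) a => w <- read QW ;; y <- read QE ;;
    ret ((e.1 || (y == L1), e.2 || [&& ~~ (e.1 || (y == L1)), a == L1 & w == L1]), a))
    (false, false) ;;
  ret (~~ r.2).

Definition print_arrow : frag unit :=
  print QF QOut ;; enq QOut L0 ;; print QE QOut ;; enq QOut L0 ;; enq QOut LSep.

Definition print_arrows : frag unit :=
  sweep QV (fun _ a => (if a == L1 then print_arrow else ret tt) ;;
    _ <- shift QF false ;; ret (tt, a)) tt.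

Definition print_member : frag unit :=
  print QTA QFam ;; enq QFam L1 ;; enq QFam LSep.

(** One element [y], held in [QE], is treated per call. The members of the family wait in [QFam]
    because the whole base has to precede them in the output. *)
Definition process : frag unit :=
  zipmap QV QE (fun _ y => y) ;; zipmap QW QE (fun _ y => y) ;; reach_both ;;
  b <- test_rep ;; zipmap QV QE (fun x y => if b then x else y) ;; enq QRep (bit b) ;;
  zipmap QTA QV (fun _ y => ~~ y) ;; print_member ;;
  zipmap QV QE (fun x y => x && ~~ y) ;; _ <- shift QF true ;; print_arrows ;;
  _ <- shift QE false ;; ret tt.

(** After the loop over all elements [QE] is the zero vector, so [QE] followed by [L1] encodes the
    singleton of the new element. *)
Definition print_trigger : frag unit :=
  zipmap QTA QB (fun _ y => y) ;; _ <- read QB ;; zipmap QTA QRep andb ;;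
  print QTA QOut ;; enq QOut L0 ;; print QE QOut ;; enq QOut L1 ;; enq QOut LSep.

(** The unary size prefix supplies at once the two counters, the zero vectors of length n, and the
    first n letters of the output's size prefix. *)
Definition emit_size (a : letter) : seq (queue * letter) :=
  [:: (QN, a); (QN2, a); (QE, L0); (QF, L0); (QV, L0); (QW, L0); (QTA, L0);
      (QTB, L0); (QOut, L1)].

Definition emit_counted (i j : queue) (a : letter) : seq (queue * letter) :=
  if a == LSep then [:: (i, a); (j, L1)] else [:: (i, a)].

Definition emit_extended (a : letter) : seq (queue * letter) :=
  if a == LSep then [:: (QOut, L0); (QOut, a)] else [:: (QOut, a)].

Definition parse : frag unit :=
  stream QIn emit_size ;; enq QOut L1 ;; enq QOut LEnd ;;
  stream QIn (emit_counted QS QK) ;; stream QIn (fun a => [:: (QP, a)]) ;;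
  stream QIn (emit_counted QB QKB).

Definition reduce : frag unit :=
  parse ;; _ <- shift QE true ;;
  times QN process ;; times QKB print_trigger ;;
  enq QOut LEnd ;; stream QFam (fun a => [:: (QOut, a)]) ;; stream QP emit_extended.

Lemma zipmap_into i j s n (A B : {set 'I_n}) :
  i != j -> s i = enc_set A -> s j = enc_set B ->
  does (S := S) (zipmap i j (fun _ y => y)) s tt (upd s i (s j)) (n * 7 + 3).
Proof.
move=> ij si sj; eapply does_eq; first exact: (does_zipmap _ ij si sj).
- by [].
- by rewrite sj; congr (upd _ _ (enc_set _)); apply/setP => x; rewrite inE.
- by [].
Qed.

Lemma nth_block u c n (A : {set 'I_n}) :
  (forall k, k < n -> nth L0 u (c + k) = nth L0 (enc_set A) k) ->
  forall k : 'I_n, nth L0 u (c + k) = bit (k \in A).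
Proof. by move=> H k; rewrite H // nth_enc. Qed.

Lemma copy_block i j s n (A B : {set 'I_n}) u c :
  i != j -> s i = enc_set A -> s j = rot c u -> c + n <= size u ->
  (forall k, k < n -> nth L0 u (c + k) = nth L0 (enc_set B) k) ->
  does (S := S) (zipmap i j (fun _ y => y)) s tt
    (upd (upd s j (rot (c + n) u)) i (enc_set B)) (n * 7 + 3).
Proof.
move=> ij si sj lc H; eapply does_eq.
- exact: (does_zipmap_at _ ij si sj lc (nth_block H)).
- by [].
- by congr (upd _ _ (enc_set _)); apply/setP => x; rewrite inE.
- by [].
Qed.

Lemma does_relax s n (V W TA TB : {set 'I_n}) ab u c :
  s QV = enc_set V -> s QW = enc_set W -> s QTA = enc_set TA -> s QTB = enc_set TB ->
  s QS = rot c u -> c + (n + n + 1) <= size u ->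
  (forall k, k < n + n + 1 -> nth L0 u (c + k) = nth L0 (enc_imp ab) k) ->
  does relax s tt
    (upd (upd (upd (upd (upd s QS (rot (c + (n + n + 1)) u))
      QTA (enc_set ab.1)) QTB (enc_set [set ab.2]))
      QV (enc_set (grow V [set ab.2] ab.1))) QW (enc_set (grow W ab.1 [set ab.2])))
    (n * 42 + 21).
Proof.
move=> sV sW sTA sTB sS lc H.
have HA k : k < n -> nth L0 u (c + k) = nth L0 (enc_set ab.1) k.
  by move=> lk; rewrite H /enc_imp ?nth_cat ?size_enc ?lk //; lia.
have HB k : k < n -> nth L0 u (c + n + k) = nth L0 (enc_set [set ab.2]) k.
  move=> lk; rewrite -addnA H /enc_imp ?nth_cat ?size_enc ?ltnNge ?leq_addr /=; last by lia.
  by rewrite addKn -ltnNge lk.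
eapply does_eq.
- eapply does_bind; first by apply: (copy_block _ sTA sS _ HA) => //; lia.
  eapply does_bind.
    apply: (copy_block (A := TB) (B := [set ab.2]) (u := u) (c := c + n)) => //; by lia.
  eapply does_bind; first by apply: (@does_read S _ _ u (c + n + n)) => //; lia.
  eapply does_bind; first by apply: (does_meets (A := V) (B := [set ab.2])).
  eapply does_bind; first by apply: (does_zipmap _ (A := V) (B := ab.1)).
  eapply does_bind; first by apply: (does_meets (A := W) (B := ab.1)).
  by apply: (does_zipmap _ (A := W) (B := [set ab.2])).
- by [].
- have -> : (c + n + n).+1 = c + (n + n + 1) by lia.
  have -> : [set x | grow_if [exists x, (x \in V) && (x \in [set ab.2])] (x \in V) (x \in ab.1)] =
    grow V [set ab.2] ab.1 by [].
  have -> : [set x | grow_if [exists x, (x \in W) && (x \in ab.1)] (x \in W) (x \in [set ab.2])] =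
    grow W ab.1 [set ab.2] by [].
  by store_eq.
- by lia.
Qed.

Lemma nth_blocks (T : Type) (x0 : T) (f : T -> seq letter) m l k i :
  (forall x, size (f x) = m) -> k < size l -> i < m ->
  nth L0 (flatten (map f l)) (k * m + i) = nth L0 (f (nth x0 l k)) i.
Proof.
move=> fm; elim: l k => [|x l IH] [|k] //= lk lm.
  by rewrite add0n nth_cat fm lm.
by rewrite nth_cat fm ltnNge mulSn -addnA leq_addr /= addKn IH.
Qed.

Lemma size_blocks (T : Type) (f : T -> seq letter) m l :
  (forall x, size (f x) = m) -> size (flatten (map f l)) = size l * m.
Proof. by move=> fm; elim: l => //= x l IH; rewrite size_cat fm IH mulSn. Qed.

Lemma size_enc_imp n (ab : imp n) : size (enc_imp ab) = n + n + 1.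
Proof. by rewrite /enc_imp !size_cat !size_enc /= addnA. Qed.

Definition vec n (s : store) j := exists A : {set 'I_n}, s j = enc_set A.

Definition same_off (l : seq queue) (s s' : store) := forall j, j \notin l -> s' j = s j.

Lemma does_relax_all s0 n (Sigma : base n) (V W : {set 'I_n}) s :
  s QV = enc_set V -> s QW = enc_set W -> vec n s QTA -> vec n s QTB ->
  s QS = enc_base Sigma -> s QK = nseq (size Sigma) L1 ->
  same_off [:: QV; QW; QTA; QTB] s0 s ->
  exists s', [/\ does (times QK relax) s tt s' (size Sigma * (n * 42 + 25) + 3),
    [/\ s' QV = enc_set (relax_all (fun ab => [set ab.2]) fst Sigma V),
        s' QW = enc_set (relax_all fst (fun ab => [set ab.2]) Sigma W),
        vec n s' QTA & vec n s' QTB]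
    & same_off [:: QV; QW; QTA; QTB] s0 s'].
Proof.
move=> sV sW sTA sTB sS sK so.
pose J k (s' : store) :=
  [/\ [/\ s' QV = enc_set (relax_all (fun ab => [set ab.2]) fst (take k Sigma) V),
        s' QW = enc_set (relax_all fst (fun ab => [set ab.2]) (take k Sigma) W),
        vec n s' QTA & vec n s' QTB],
     s' QS = rot (k * (n + n + 1)) (enc_base Sigma)
    & same_off [:: QV; QW; QTA; QTB; QS; QK] s0 s'].
have sz : size (enc_base Sigma) = size Sigma * (n + n + 1).
  exact: size_blocks (@size_enc_imp n).
have [|||s' [H1 [H2 H3 H4] H5]] := @does_times S QK relax _ J (n * 42 + 21) s _ _ sK.
- by apply/negP => /nseqP [].
- rewrite size_nseq => k s1 lk [[V1 W1 [TA A1] [TB B1]] S1 O1].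
  (* The default for [nth] has to come from [Sigma], as there is no implication on an empty ground
     set. *)
  have x0 : imp n by case: (Sigma) lk.
  eexists; split.
  + apply: (does_relax (ab := nth x0 Sigma k) V1 W1 A1 B1 S1).
      by rewrite sz -mulSnr leq_mul2r lk orbT.
    move=> i li; exact: (nth_blocks _ (@size_enc_imp n) lk li).
  + by [].
  + move=> q; split.
    * rewrite !(take_nth x0 lk) /relax_all -!cats1 !foldl_cat; split=> //.
        by exists (nth x0 Sigma k).1.
      by exists [set (nth x0 Sigma k).2].
    * by rewrite mulSnr.
    * by frame O1.
- move=> q; split.
  + rewrite take0; split=> //.
  + by rewrite mul0n rot0.
  + by frame so.
rewrite size_nseq in H1 H2 H3; exists s'; split.
- apply: does_le H1 _; lia.
- by rewrite take_size in H2.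
(* The base queue has been rotated by all its blocks, that is by its full length, so it is back in
   place. *)
move=> j jn; case: (j =P QS) => [->|/eqP jS].
  by rewrite H3 -sz rot_size -sS -so.
case: (j =P QK) => [->|/eqP jK]; first by rewrite H5 -sK -so.
apply: H4; move: jn; rewrite !inE !negb_or jS jK.
by case/and4P => -> -> -> ->.
Qed.

Lemma does_reach_both s0 n (Sigma : base n) y :
  s0 QV = enc_set [set y] -> s0 QW = enc_set [set y] -> vec n s0 QTA -> vec n s0 QTB ->
  s0 QS = enc_base Sigma -> s0 QK = nseq (size Sigma) L1 -> s0 QN2 = nseq n L1 ->
  exists s', [/\ does reach_both s0 tt s' (n * (size Sigma * (n * 42 + 25) + 7) + 3),
    [/\ s' QV = enc_set [set x | reach Sigma x y],
        s' QW = enc_set [set x | reach Sigma y x],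
        vec n s' QTA & vec n s' QTB]
    & same_off [:: QV; QW; QTA; QTB] s0 s'].
Proof.
move=> sV sW sTA sTB sS sK sN.
pose J k (s' : store) :=
  [/\ s' QV = enc_set (iter k (relax_all (fun ab => [set ab.2]) fst Sigma) [set y]),
      s' QW = enc_set (iter k (relax_all fst (fun ab => [set ab.2]) Sigma) [set y]),
      vec n s' QTA, vec n s' QTB
    & same_off [:: QV; QW; QTA; QTB; QN2] s0 s'].
have [|||s' [H1 [V' W' A' B' O'] H5]] :=
  @does_times S QN2 (times QK relax) _ J (size Sigma * (n * 42 + 25) + 3) s0 _ _ sN.
- by apply/negP => /nseqP [].
- rewrite size_nseq => k s1 lk [V1 W1 A1 B1 O1].
  have S1 : s1 QS = enc_base Sigma by rewrite O1.
  have K1 : s1 QK = nseq (size Sigma) L1 by rewrite O1.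
  have [//|s2 [H2 [V2 W2 A2 B2] O2]] := does_relax_all (s0 := s1) V1 W1 A1 B1 S1 K1.
  exists s2; split=> //; first by rewrite O2.
  move=> q; split=> //.
  move=> j jn; have := O1 j jn; have := O2 j; move: jn.
  by case: j => // _ H <-; exact: (H isT).
- by move=> q; split=> //; case.
rewrite size_nseq in H1 V' W' O'; exists s'; split.
- apply: does_le H1 _; lia.
- by rewrite V' W' relax_ancestors relax_descendants.
move=> j jn; have := O' j; move: jn; case: j => //= _; try by apply.
by rewrite H5 sN.
Qed.

(** An index register with a single 1. It is empty for [k = n], so [n] shifts starting from index 0
    leave the zero vector. *)
Definition first_only k n : {set 'I_n} := [set x : 'I_n | x == k :> nat].

Lemma does_test_rep s n (Sigma : base n) (y : 'I_n) :
  s QV = enc_set [set x | reach Sigma x y] -> s QW = enc_set [set x | reach Sigma y x] ->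
  s QE = enc_set [set y] ->
  does test_rep s (is_rep Sigma y) s (n * 10 + 4).
Proof.
move=> sV sW sE.
pose st k := upd (upd s QW (rot k (s QW))) QE (rot k (s QE)).
(* At [k = n] the bound [u < k] is void and the second component becomes the negation of
   [is_rep]. *)
pose e k := (y < k, [exists u : 'I_n, [&& u < k, u < y, reach Sigma u y & reach Sigma y u]]).
have Hs : does (S := S) (sweep QV (fun (e : bool * bool) a => w <- read QW ;; y <- read QE ;;
    ret ((e.1 || (y == L1), e.2 || [&& ~~ (e.1 || (y == L1)), a == L1 & w == L1]), a))
    (false, false)) s (e n) s (n * (7 + 3) + 3).
  apply: (does_sweep_set (A := [set x | reach Sigma x y]) (A' := [set x | reach Sigma x y])
    (e := e) (st := st)) => //.
  - move=> k q.
    have lW : k < size (s QW) by rewrite sW size_enc.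
    have lE : k < size (s QE) by rewrite sE size_enc.
    eapply does_eq.
    + eapply does_bind; first by apply: (@does_read S _ _ (s QW) k).
      eapply does_bind; first by apply: (@does_read S _ _ (s QE) k).
      exact: does_ret.
    + have seenE : (y < k) || (k \in [set y]) = (y < k.+1).
        by rewrite inE ltnS (leq_eqVlt y k) orbC (eq_sym k).
      rewrite sW sE !nth_enc !bitE /e [fst _]/= [snd _]/= seenE ltnS -ltnNge !inE.
      congr (_, _, _); apply/orP/existsP.
        case=> [/existsP [u /andP [uk H]]|/and3P [ky ku uk]].
          by exists u; rewrite H (leq_trans uk).
        by exists k; rewrite ltnSn ky ku uk.
      case=> u /and4P []; rewrite ltnS leq_eqVlt => /orP [/eqP/val_inj ->|uk] uy r1 r2.
        by right; rewrite uy r1 r2.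
      by left; apply/existsP; exists u; rewrite uk uy r1 r2.
    + by rewrite /st; store_eq.
    + by [].
  - by rewrite /e ltn0; congr (_, _); apply/existsP; case.
  - by rewrite /st !rot0 !upd_same -sV upd_same.
  - by rewrite /st !rot_oversize ?sW ?sE ?size_enc // -sW -sE !upd_same -sV upd_same.
eapply does_eq; first by eapply does_bind; [exact: Hs|exact: does_ret].
- rewrite /= /is_rep; congr (~~ _); apply: eq_existsb => u.
  by rewrite ltn_ord.
- by [].
- by lia.
Qed.

(** The new element is the last ordinal, so enlarging the ground set only appends one bit to an
    encoding. *)
Lemma enc_lift n (A : {set 'I_n}) : enc_set (lift_set A) = rcons (enc_set A) L0.
Proof.
rewrite /enc_set enum_ordSr map_rcons z_lift -map_comp; congr rcons.
by apply: eq_map => x /=; rewrite old_lift.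
Qed.

Lemma enc_zlift n (A : {set 'I_n}) :
  enc_set (ord_max |: lift_set A) = rcons (enc_set A) L1.
Proof.
rewrite /enc_set enum_ordSr map_rcons setU11 -map_comp; congr rcons.
by apply: eq_map => x /=; rewrite in_setU1 (negbTE (old_neq x)) old_lift.
Qed.

Lemma enc_old n (x : 'I_n) : enc_set [set old x] = rcons (enc_set [set x]) L0.
Proof. by rewrite -enc_lift /lift_set imset_set1. Qed.

Lemma enc_z n : enc_set [set @ord_max n] = rcons (enc_set (set0 : {set 'I_n})) L1.
Proof. by rewrite -enc_zlift /lift_set imset0 setU0. Qed.

Lemma first_only_n n : first_only n n = set0.
Proof. by apply/setP => x; rewrite !inE; have := ltn_ord x; case: ltngtP. Qed.

Lemma first_only_val n (y : 'I_n) : first_only y n = [set y].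
Proof. by apply/setP => x; rewrite !inE. Qed.

Lemma shift_first s j k n : s j = enc_set (first_only k n) ->
  exists b, does (S := S) (shift j false) s b (upd s j (enc_set (first_only k.+1 n))) (n * 4 + 3).
Proof.
move=> sj; eexists; eapply does_eq; first exact: (does_shift (P := pred1 k) false sj).
- by [].
- by congr (upd _ _ (enc_set _)); apply/setP => x; rewrite !inE; case: (x : nat).
- by [].
Qed.

Lemma shift_zero s j n : s j = enc_set (set0 : {set 'I_n}) ->
  exists b, does (S := S) (shift j true) s b (upd s j (enc_set (first_only 0 n))) (n * 4 + 3).
Proof.
move=> sj; have sj' : s j = enc_set [set x : 'I_n | pred0 (x : nat)].
  by rewrite sj; congr enc_set; apply/setP => x; rewrite !inE.
eexists; eapply does_eq; first exact: (does_shift true sj').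
- by [].
- by congr (upd _ _ (enc_set _)); apply/setP => x; rewrite !inE; case: (x : nat).
- by [].
Qed.

Lemma does_print_arrow s n (x y : 'I_n) :
  s QF = enc_set [set x] -> s QE = enc_set [set y] ->
  does print_arrow s tt (upd s QOut (s QOut ++ enc_imp ([set old x], old y))) (n * 10 + 9).
Proof.
move=> sF sE; eapply does_eq.
- eapply does_bind; first by apply: does_print; rewrite ?sF ?end_enc.
  eapply does_bind; first exact: does_enq.
  eapply does_bind; first by apply: does_print; rewrite ?/upd /= ?sE ?end_enc.
  by eapply does_bind; exact: does_enq.
- by [].
- rewrite /enc_imp !enc_old !updE /= sE sF -!cats1 -!catA.
  by store_eq.
- by rewrite /upd /= sE sF !size_enc; lia.
Qed.

Lemma does_print_arrows s n (A : {set 'I_n}) (y : 'I_n) :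
  s QV = enc_set A -> s QF = enc_set (first_only 0 n) -> s QE = enc_set [set y] ->
  does print_arrows s tt
    (upd (upd s QF (enc_set (set0 : {set 'I_n}))) QOut
       (s QOut ++ enc_base [seq ([set old x], old y) | x <- enum 'I_n & x \in A]))
    (n * (n * 14 + 16) + 3).
Proof.
move=> sV sF sE.
pose out k := s QOut ++ enc_base [seq ([set old x], old y) | x <- take k (enum 'I_n) & x \in A].
pose st k := upd (upd s QF (enc_set (first_only k n))) QOut (out k).
have H : does (sweep QV (fun _ a => (if a == L1 then print_arrow else ret tt) ;;
    _ <- shift QF false ;; ret (tt, a)) tt) s tt (upd (st n) QV (enc_set A))
    (n * (n * 14 + 13 + 3) + 3).
  apply: (does_sweep_set (A := A) (A' := A) (e := fun=> tt) (st := st)) => //; last first.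
    rewrite /st /out take0 /= cats0 -sF; store_eq.
  move=> k q; rewrite bitE.
  have outS : out k.+1 = out k ++ if k \in A then enc_imp ([set old k], old y) else [::].
    rewrite /out (take_nth k) ?size_enum_ord // nth_ord_enum filter_rcons -catA.
    case: ifP => kA; last by rewrite cats0.
    by rewrite map_rcons /enc_base map_rcons flatten_rcons.
  pose s1 := upd (upd (upd s QF (enc_set (first_only k n))) QOut (out k.+1)) QV q.
  have H1 : does (S := S) (if k \in A then print_arrow else ret tt) (upd (st k) QV q) tt s1 (n * 10 + 9).
    rewrite /s1 outS; case: ifP => kA.
      eapply does_eq.
      - apply: (@does_print_arrow _ n k y); first by rewrite -first_only_val.
        by rewrite -sE.
      - by [].
      - by rewrite /st !updE /=; store_eq.
      - by [].
    eapply does_eq; [exact: does_ret|by []| |by lia].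
    by rewrite cats0.
  have [b H2] := @shift_first s1 QF k n erefl.
  eapply does_eq.
  - eapply does_bind; first exact: H1.
    by eapply does_bind; [exact: H2|exact: does_ret].
  - by [].
  - by rewrite /s1 /st; store_eq.
  - by lia.
eapply does_eq; first exact: H.
- by [].
- rewrite /st /out first_only_n take_oversize ?size_enum_ord // -sV.
  by store_eq.
- by lia.
Qed.

(** The first term is the cost of the reachability computation, the second that of printing the
    arrows; the remaining vector operations are linear in [n]. *)
Definition process_cost n m :=
  n * (m * (n * 42 + 25) + 7) + n * (n * 14 + 16) + n * 70 + 50.

Lemma does_process s n (Sigma : base n) (y : 'I_n) :
  vec n s QV -> vec n s QW -> vec n s QTA -> vec n s QTB ->
  s QE = enc_set (first_only y n) -> s QF = enc_set (set0 : {set 'I_n}) ->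
  s QS = enc_base Sigma -> s QK = nseq (size Sigma) L1 -> s QN2 = nseq n L1 ->
  exists s', [/\ does process s tt s' (process_cost n (size Sigma)),
    [/\ s' QE = enc_set (first_only y.+1 n), s' QF = enc_set (set0 : {set 'I_n}),
        s' QRep = rcons (s QRep) (bit (is_rep Sigma y)),
        s' QFam = s QFam ++ enc_set (ord_max |: lift_set (~: anc Sigma y)) ++ [:: LSep]
      & s' QOut = s QOut ++ enc_base (arrows_to Sigma y)],
    [/\ vec n s' QV, vec n s' QW, vec n s' QTA & vec n s' QTB]
    & same_off [:: QE; QF; QRep; QFam; QOut; QV; QW; QTA; QTB] s s'].
Proof.
move=> [V sV] [W sW] [TA sTA] [TB sTB] sE sF sS sK sN.
rewrite first_only_val in sE.
pose s1 := upd (upd s QV (s QE)) QW (s QE).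
have := @does_reach_both s1 n Sigma y sE sE _ _ sS sK sN.
case=> [||s2 [H2 [V2 W2 [TA2 A2] B2] O2]]; [by exists TA|by exists TB|].
have E2 : s2 QE = enc_set [set y] by rewrite O2.
pose s3 := upd s2 QV (enc_set (anc Sigma y)).
pose s4 := upd s3 QRep (rcons (s2 QRep) (bit (is_rep Sigma y))).
pose s5 := upd s4 QTA (enc_set (~: anc Sigma y)).
pose s6 := upd s5 QFam (s2 QFam ++ enc_set (ord_max |: lift_set (~: anc Sigma y)) ++ [:: LSep]).
pose s7 := upd s6 QV (enc_set [set x in anc Sigma y | x != y]).
have [b H8] : exists b, does (S := S) (shift QF true) s7 b (upd s7 QF (enc_set (first_only 0 n))) (n * 4 + 3).
  by apply: shift_zero; rewrite -sF; exact: (O2 QF isT).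
pose s8 := upd s7 QF (enc_set (first_only 0 n)).
have H9 := @does_print_arrows s8 n [set x in anc Sigma y | x != y] y erefl erefl E2.
set s9 := upd _ _ _ in H9.
have [b' H10] : exists b, does (S := S) (shift QE false) s9 b (upd s9 QE (enc_set (first_only y.+1 n))) (n * 4 + 3).
  by apply: shift_first; rewrite first_only_val; exact: E2.
set s10 := upd _ _ _ in H10.
have H3 : does (S := S) (zipmap QV QE (fun x w => if is_rep Sigma y then x else w)) s2 tt s3 (n * 7 + 3).
  eapply does_eq; first by apply: (does_zipmap _ (A := [set x | reach Sigma x y]) (B := [set y])).
  - by [].
  - rewrite /s3 /anc; congr (upd _ _ (enc_set _)); apply/setP => x; rewrite inE.
    by case: ifP.
  - by [].
have H5 : does (S := S) (zipmap QTA QV (fun _ w => ~~ w)) s4 tt s5 (n * 7 + 3).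
  eapply does_eq; first by apply: (does_zipmap _ (A := TA2) (B := anc Sigma y)).
  - by [].
  - by rewrite /s5; congr (upd _ _ (enc_set _)); apply/setP => x; rewrite !inE.
  - by [].
have H6 : does (S := S) print_member s5 tt s6 (n * 5 + 5).
  eapply does_eq.
  - eapply does_bind; first by apply: does_print; rewrite // end_enc.
    by eapply does_bind; exact: does_enq.
  - by [].
  - rewrite /s6 enc_zlift /s5 /upd /=; apply: functional_extensionality => j.
    by case: j => //=; rewrite -!cats1 -!catA.
  - by rewrite /s5 /upd /= size_enc; lia.
have H7 : does (S := S) (zipmap QV QE (fun x w => x && ~~ w)) s6 tt s7 (n * 7 + 3).
  eapply does_eq; first by apply: (does_zipmap _ (A := anc Sigma y) (B := [set y])).
  - by [].
  - by rewrite /s7; congr (upd _ _ (enc_set _)); apply/setP => x; rewrite !inE.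
  - by [].
exists s10; split.
- rewrite /process.
  eapply does_eq.
  + eapply does_bind; first by apply: (zipmap_into (A := V) (B := [set y])).
    eapply does_bind; first by apply: (zipmap_into (A := W) (B := [set y])).
    eapply does_bind; first exact: H2.
    eapply does_bind; first exact: (does_test_rep V2 W2 E2).
    eapply does_bind; first exact: H3.
    eapply does_bind; first exact: does_enq.
    eapply does_bind; first exact: H5.
    eapply does_bind; first exact: H6.
    eapply does_bind; first exact: H7.
    eapply does_bind; first exact: H8.
    eapply does_bind; first exact: H9.
    by eapply does_bind; [exact: H10|exact: does_ret].
  + by [].
  + by [].
  + by rewrite /process_cost; lia.
- split.
  + by [].
  + by [].
  + by have <- : s2 QRep = s QRep := O2 QRep isT.
  + by have <- : s2 QFam = s QFam := O2 QFam isT.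
  + have <- : s2 QOut = s QOut := O2 QOut isT; congr (_ ++ enc_base _).
    rewrite /arrows_to; congr map; apply: eq_filter => x; by rewrite inE.
- split.
  + by exists [set x in anc Sigma y | x != y].
  + by exists [set x | reach Sigma y x].
  + by exists (~: anc Sigma y).
  + exact: B2.
by frame O2.
Qed.

Lemma enc_base_cat n (s t : base n) : enc_base (s ++ t) = enc_base s ++ enc_base t.
Proof. by rewrite /enc_base map_cat flatten_cat. Qed.

Lemma enc_family_cat n (s t : seq {set 'I_n}) : enc_family (s ++ t) = enc_family s ++ enc_family t.
Proof. by rewrite /enc_family map_cat flatten_cat. Qed.

Lemma enc_set0 n : enc_set (set0 : {set 'I_n}) = nseq n L0.
Proof.
rewrite -[in RHS](size_enum_ord n) /enc_set.
by elim: (enum _) => //= x s ->; rewrite inE.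
Qed.

Definition looped n (Sigma : base n) o k (s : store) :=
  [/\ s QE = enc_set (first_only k n), s QF = enc_set (set0 : {set 'I_n}),
      s QRep = [seq bit (is_rep Sigma y) | y <- take k (enum 'I_n)],
      s QFam = enc_family [seq ord_max |: lift_set (~: anc Sigma y) | y <- take k (enum 'I_n)]
    & s QOut = o ++ enc_base (flatten [seq arrows_to Sigma y | y <- take k (enum 'I_n)])].

Lemma does_process_all s0 n (Sigma : base n) o :
  vec n s0 QV -> vec n s0 QW -> vec n s0 QTA -> vec n s0 QTB ->
  looped Sigma o 0 s0 ->
  s0 QS = enc_base Sigma -> s0 QK = nseq (size Sigma) L1 -> s0 QN2 = nseq n L1 ->
  s0 QN = nseq n L1 ->
  exists s', [/\ does (S := S) (times QN process) s0 tt s' (n * (process_cost n (size Sigma) + 4) + 3),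
    looped Sigma o n s', vec n s' QTA
    & same_off [:: QE; QF; QRep; QFam; QOut; QV; QW; QTA; QTB; QN] s0 s'].
Proof.
move=> sV sW sTA sTB sL sS sK sN2 sN.
pose J k (s' : store) :=
  [/\ looped Sigma o k s', [/\ vec n s' QV, vec n s' QW, vec n s' QTA & vec n s' QTB]
    & same_off [:: QE; QF; QRep; QFam; QOut; QV; QW; QTA; QTB; QN] s0 s'].
have [|||s' [H1 [H2 [_ _ H3 _] H4] H5]] :=
  @does_times S QN process _ J (process_cost n (size Sigma)) s0 _ _ sN.
- by apply/negP => /nseqP [].
- rewrite size_nseq => k s1 lk [[E1 F1 R1 M1 U1] [V1 W1 A1 B1] O1].
  have S1 : s1 QS = enc_base Sigma by rewrite O1.
  have K1 : s1 QK = nseq (size Sigma) L1 by rewrite O1.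
  have N1 : s1 QN2 = nseq n L1 by rewrite O1.
  have := @does_process s1 n Sigma (Ordinal lk) V1 W1 A1 B1 E1 F1 S1 K1 N1.
  case=> s2 [H2 [E2 F2 R2 M2 U2] V2 O2].
  have tk : take k.+1 (enum 'I_n) = rcons (take k (enum 'I_n)) (Ordinal lk).
    by rewrite (take_nth (Ordinal lk)) ?size_enum_ord // (nth_ord_enum (Ordinal lk) (Ordinal lk)).
  exists s2; split=> //; first by rewrite O2.
  move=> q; split=> //.
    split=> //; rewrite tk !map_rcons.
    + by rewrite -R1.
    + by rewrite -cats1 enc_family_cat -M1 /enc_family /= cats0.
    + by rewrite flatten_rcons enc_base_cat catA -U1.
  move=> j jn; have := O1 j jn; have := O2 j; move: jn.
  by case: j => // _ H <-; exact: (H isT).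
- by move=> q; split=> //; case.
rewrite size_nseq in H1 H2 H3 H4.
by exists s'; split.
Qed.

Lemma enc_reps n (Sigma : base n) :
  [seq bit (is_rep Sigma y) | y <- enum 'I_n] = enc_set (reps Sigma).
Proof. by apply: eq_map => y; rewrite inE. Qed.

Lemma does_print_trigger s n (Sigma : base n) (A B : {set 'I_n}) u c :
  s QTA = enc_set A -> s QB = rot c u -> c + (n + 1) <= size u ->
  (forall k, k < n -> nth L0 u (c + k) = nth L0 (enc_set B) k) ->
  s QRep = enc_set (reps Sigma) -> s QE = enc_set (set0 : {set 'I_n}) ->
  does (S := S) print_trigger s tt
    (upd (upd (upd s QB (rot (c + (n + 1)) u)) QTA (enc_set (B :&: reps Sigma)))
      QOut (s QOut ++ enc_imp (lift_set (B :&: reps Sigma), ord_max)))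
    (n * 24 + 18).
Proof.
move=> sA sB lc H sR sE.
pose s1 := upd (upd s QB (rot (c + (n + 1)) u)) QTA (enc_set (B :&: reps Sigma)).
eapply does_eq.
- eapply does_bind; first by apply: (copy_block _ sA sB _ H) => //; lia.
  eapply does_bind; first by apply: (@does_read S _ _ u (c + n)) => //; lia.
  eapply does_bind; first by apply: (does_zipmap _ (A := B) (B := reps Sigma)).
  eapply does_bind; first by apply: does_print; rewrite // end_enc.
  eapply does_bind; first exact: does_enq.
  eapply does_bind; first by apply: does_print; rewrite // ?/upd /= ?sE ?end_enc.
  by eapply does_bind; exact: does_enq.
- by [].
- have -> : (c + n).+1 = c + (n + 1) by lia.
  have -> : [set x | (x \in B) && (x \in reps Sigma)] = B :&: reps Sigma.
    by apply/setP => x; rewrite !inE.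
  rewrite /enc_imp enc_z enc_lift; apply: functional_extensionality => j.
  by case: j => //=; rewrite /upd /= sE -!cats1 -!catA.
- by rewrite /upd /= sE !size_enc; lia.
Qed.

Lemma does_print_triggers s0 n (Sigma : base n) (Bm : seq {set 'I_n}) o :
  vec n s0 QTA -> s0 QB = enc_family Bm -> s0 QKB = nseq (size Bm) L1 ->
  s0 QRep = enc_set (reps Sigma) -> s0 QE = enc_set (set0 : {set 'I_n}) ->
  s0 QOut = o ->
  exists s', [/\ does (S := S) (times QKB print_trigger) s0 tt s' (size Bm * (n * 24 + 22) + 3),
    s' QOut = o ++ enc_base [seq (lift_set (B :&: reps Sigma), ord_max) | B <- Bm]
    & same_off [:: QTA; QOut; QB; QKB] s0 s'].
Proof.
move=> sA sB sK sR sE sO.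
have sz : size (enc_family Bm) = size Bm * (n + 1).
  by apply: size_blocks => B; rewrite size_cat size_enc.
pose J k (s' : store) :=
  [/\ vec n s' QTA, s' QB = rot (k * (n + 1)) (enc_family Bm),
      s' QOut = o ++ enc_base [seq (lift_set (B :&: reps Sigma), ord_max) | B <- take k Bm]
    & same_off [:: QTA; QOut; QB; QKB] s0 s'].
have [|||s' [H1 [H2 H3 H4 H5] _]] := @does_times S QKB print_trigger _ J (n * 24 + 18) s0 _ _ sK.
- by apply/negP => /nseqP [].
- rewrite size_nseq => k s1 lk [[A A1] B1 U1 O1].
  have R1 : s1 QRep = enc_set (reps Sigma) by rewrite O1.
  have E1 : s1 QE = enc_set (set0 : {set 'I_n}) by rewrite O1.
  eexists; split.
  + apply: (does_print_trigger (B := nth set0 Bm k) A1 B1 _ _ R1 E1).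
      by rewrite sz -mulSnr leq_mul2r lk orbT.
    move=> i li; rewrite /enc_family.
    rewrite (nth_blocks set0 (m := n + 1)) //.
    * by rewrite nth_cat size_enc li.
    * by move=> B; rewrite size_cat size_enc.
    * by lia.
  + by [].
  + move=> q; split.
    * by exists (nth set0 Bm k :&: reps Sigma).
    * by rewrite mulSnr.
    * rewrite (take_nth set0 lk) map_rcons -cats1 enc_base_cat catA -U1.
      by rewrite /enc_base /= cats0.
    * by frame O1.
- move=> q; split=> //; first by rewrite mul0n rot0.
  + by rewrite take0 /enc_base /= cats0.
  + by case.
rewrite size_nseq in H1 H4; exists s'; split=> //.
- apply: does_le H1 _; lia.
- by rewrite H4 take_size.
Qed.

Lemma emitted_flatten (em : letter -> seq (queue * letter)) w s j :
  emitted (flatten (map em w)) s j =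
  s j ++ flatten [seq [seq p.2 | p <- em a & p.1 == j] | a <- w].
Proof. by rewrite /emitted filter_flatten map_flatten -!map_comp. Qed.

Lemma emitted_size n s : emitted (flatten (map emit_size (nseq n L1))) s =
  fun j => s j ++ match j with
    | QN | QN2 | QOut => nseq n L1
    | QE | QF | QV | QW | QTA | QTB => nseq n L0
    | _ => [::] end.
Proof.
apply: functional_extensionality => j; rewrite emitted_flatten; congr (_ ++ _).
by case: j; elim: n => //= n ->.
Qed.

Lemma emitted_counted i j w s : i != j ->
  emitted (flatten (map (emit_counted i j) w)) s =
  upd (upd s i (s i ++ w)) j (s j ++ nseq (count_mem LSep w) L1).
Proof.
move=> ij; apply: functional_extensionality => k; rewrite emitted_flatten /upd.
case: (k =P j) => [->|/eqP kj].
  congr (_ ++ _); elim: w => //= a w ->; rewrite /emit_counted.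
  by case: ifP => _ /=; rewrite (negbTE ij) //= eqxx.
case: (k =P i) => [->|/eqP ki].
  congr (_ ++ _); elim: w => //= a w ->; rewrite /emit_counted.
  by case: ifP => _ /=; rewrite eqxx //= eq_sym (negbTE ij).
rewrite -[RHS]cats0; congr (_ ++ _); elim: w => //= a w ->; rewrite /emit_counted.
by case: ifP => _ /=; rewrite !(eq_sym _ k) (negbTE ki) ?(negbTE kj).
Qed.

Lemma emitted_copy i w s :
  emitted (flatten (map (fun a => [:: (i, a)]) w)) s = upd s i (s i ++ w).
Proof.
apply: functional_extensionality => k; rewrite emitted_flatten /upd.
case: (k =P i) => [->|/eqP ki].
  by congr (_ ++ _); elim: w => //= a w ->; rewrite eqxx.
by rewrite -[RHS]cats0; congr (_ ++ _); elim: w => //= a w ->; rewrite eq_sym (negbTE ki).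
Qed.

Lemma sep_enc n (A : {set 'I_n}) : LSep \notin enc_set A.
Proof. by apply/negP => /mapP [i _]; case: ifP. Qed.

(** Inside a set no letter is [LSep], so the extra bit lands exactly at the end of each set, as
    [enc_lift] requires. *)
Lemma emitted_extended n (Bp : seq {set 'I_n}) s :
  emitted (flatten (map emit_extended (enc_family Bp))) s =
  upd s QOut (s QOut ++ enc_family (map (@lift_set n) Bp)).
Proof.
apply: functional_extensionality => k; rewrite emitted_flatten /upd.
have out_set (A : {set 'I_n}) :
    flatten [seq [seq p.2 | p <- emit_extended a & p.1 == QOut] | a <- enc_set A] = enc_set A.
  elim: (enc_set A) (sep_enc A) => //= a w IH.
  rewrite inE negb_or eq_sym => /andP [/negbTE aS /IH ->].
  by rewrite /emit_extended aS.
case: (k =P QOut) => [->|/eqP ki]; last first.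
  rewrite -[RHS]cats0; congr (_ ++ _); elim: (enc_family Bp) => //= a w ->.
  by rewrite /emit_extended; case: ifP => _ /=; rewrite eq_sym (negbTE ki).
congr (_ ++ _); elim: Bp => //= B Bp IH.
rewrite /enc_family /= -/(enc_family Bp) -/(enc_family (map _ Bp)) !map_cat !flatten_cat out_set IH /=.
by rewrite enc_lift -cats1 -!catA.
Qed.

Lemma end_enc_base n (s : base n) : LEnd \notin enc_base s.
Proof.
elim: s => //= ab s IH; rewrite /enc_base /= !mem_cat !negb_or !end_enc /=.
by rewrite -/(enc_base s) IH.
Qed.

Lemma end_enc_family n (s : seq {set 'I_n}) : LEnd \notin enc_family s.
Proof.
elim: s => //= B s IH; rewrite /enc_family /= !mem_cat !negb_or !end_enc /=.
by rewrite -/(enc_family s) IH.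
Qed.

Lemma count_sep_base n (s : base n) : count_mem LSep (enc_base s) = size s.
Proof.
elim: s => //= ab s IH; rewrite /enc_base /= !count_cat /= -/(enc_base s) IH.
by rewrite !(count_memPn (sep_enc _)).
Qed.

Lemma count_sep_family n (s : seq {set 'I_n}) : count_mem LSep (enc_family s) = size s.
Proof.
elim: s => //= B s IH; rewrite /enc_family /= !count_cat /= -/(enc_family s) IH.
by rewrite !(count_memPn (sep_enc _)).
Qed.

Definition parsed n (Sigma : base n) (Bp Bm : seq {set 'I_n}) : store := fun j =>
  match j with
  | QN | QN2 => nseq n L1
  | QE | QF | QV | QW | QTA | QTB => enc_set (set0 : {set 'I_n})
  | QS => enc_base Sigma
  | QK => nseq (size Sigma) L1
  | QP => enc_family Bp
  | QB => enc_family Bm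
  | QKB => nseq (size Bm) L1
  | QOut => nseq n.+1 L1 ++ [:: LEnd]
  | _ => [::]
  end.

(** The factor 12 comes from the size prefix: each of its letters is sent to nine queues, with three
    further operations. *)
Lemma does_parse n (Sigma : base n) (Bp Bm : seq {set 'I_n}) :
  does (S := S) parse (input_store (enc_DUAL Sigma Bp Bm)) tt (parsed Sigma Bp Bm)
    (size (enc_DUAL Sigma Bp Bm) * 12 + 10).
Proof.
set s := input_store _.
pose r3 := enc_family Bm.
pose r2 := enc_family Bp ++ LEnd :: r3.
pose r1 := enc_base Sigma ++ LEnd :: r2.
have s0i : s QIn = nseq n L1 ++ LEnd :: r1 by [].
have H1 := @does_stream S QIn emit_size 9 (nseq n L1) (LEnd :: r1) s.
rewrite emitted_size [behead _]/= in H1.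
set s1 := upd _ _ _ in H1.
pose s2 := upd s1 QOut (nseq n.+1 L1 ++ [:: LEnd]).
have H2 := @does_stream S QIn (emit_counted QS QK) 2 (enc_base Sigma) (LEnd :: r2) s2.
rewrite emitted_counted // [behead _]/= in H2.
set s3 := upd _ _ _ in H2.
have H3 := @does_stream S QIn (fun a => [:: (QP, a)]) 1 (enc_family Bp) (LEnd :: r3) s3.
rewrite emitted_copy // [behead _]/= in H3.
set s4 := upd _ _ _ in H3.
have H4 := @does_stream S QIn (emit_counted QB QKB) 2 (enc_family Bm) [::] s4.
rewrite emitted_counted // [behead _]/= in H4.
have counted i j : i != QIn -> j != QIn -> forall a, all (fun p : queue * letter => p.1 != QIn) (emit_counted i j a).
  by move=> iI jI a; rewrite /emit_counted; case: ifP => _ /=; rewrite iI ?jI.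
have counted2 i j a : size (emit_counted i j a) <= 2 by rewrite /emit_counted; case: ifP.
eapply does_eq.
- eapply does_bind; first by apply: H1 => //; apply/negP => /nseqP [].
  have E : upd (upd s1 QOut (rcons (s1 QOut) L1)) QOut
     (rcons (upd s1 QOut (rcons (s1 QOut) L1) QOut) LEnd) = s2.
    rewrite upd_upd /s2; congr upd; rewrite updE eqxx.
    have -> : s1 QOut = nseq n L1 by [].
    by rewrite -!cats1 -(nseqD n 1) addn1.
  eapply does_bind; first exact: does_enq.
  eapply does_bind; first exact: does_enq.
  rewrite E.
  eapply does_bind; first by apply: H2 => //; [exact: end_enc_base|exact: counted].
  eapply does_bind; first by apply: H3 => //; exact: end_enc_family.
  apply: H4 => //; [exact: end_enc_family|by rewrite cats0|exact: counted].
- by [].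
- apply: functional_extensionality => j; case: j => //=.
  all: rewrite /s4 /s3 /s2 /s1 /upd /= ?enc_set0 ?count_sep_base ?count_sep_family //.
- rewrite /enc_DUAL !size_cat /= !size_nseq; lia.
Qed.

Definition reduce_cost (N : nat) : nat :=
  N * (process_cost N N) + N * (N * 28 + 50) + N * (N * 4 + 50) + 40.

Lemma process_cost_le n m N : n <= N -> m <= N -> process_cost n m <= process_cost N N.
Proof.
move=> ln lm; rewrite /process_cost !leq_add // ?leq_mul // ?leq_add // ?leq_mul //.
all: by rewrite leq_add2r leq_mul.
Qed.

Lemma size_family n (s : seq {set 'I_n}) : size (enc_family s) = size s * (n + 1).
Proof. by apply: size_blocks => B; rewrite size_cat size_enc. Qed.

Lemma does_reduce n (Sigma : base n) (Bp Bm : seq {set 'I_n}) :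
  let w := enc_DUAL Sigma Bp Bm in
  exists s', does (S := S) reduce (input_store w) tt s' (reduce_cost (size w)) /\
    s' QOut = enc_CMI (cmi_base Sigma Bm) (cmi_family Sigma Bp).
Proof.
move=> w; set s0 := input_store w; set s1 := parsed Sigma Bp Bm.
have [b H2] : exists b, does (S := S) (shift QE true) s1 b (upd s1 QE (enc_set (first_only 0 n))) (n * 4 + 3).
  exact: shift_zero.
set s2 := upd _ _ _ in H2.
have [|||||s3 [H3 [E3 F3 R3 M3 U3] A3 O3]] :=
  @does_process_all s2 n Sigma (nseq n.+1 L1 ++ [:: LEnd]) _ _ _ _ _ erefl erefl erefl erefl.
- by exists set0.
- by exists set0.
- by exists set0.
- by exists set0.
- by split=> //; rewrite take0 //= /enc_base /= cats0.
have te : take n (enum 'I_n) = enum 'I_n by rewrite take_oversize // size_enum_ord.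
rewrite first_only_n in E3; rewrite te enc_reps in R3; rewrite te in M3 U3.
have [s4 [H4 U4 O4]] := @does_print_triggers s3 n Sigma Bm _ A3 (O3 QB isT) (O3 QKB isT) R3 E3 U3.
pose s5 := upd s4 QOut (rcons (s4 QOut) LEnd).
have M5 : s5 QFam = enc_family [seq ord_max |: lift_set (~: anc Sigma y) | y <- enum 'I_n] ++ [::].
  by rewrite cats0 -M3; exact: (O4 QFam isT).
have P5 : s4 QP = enc_family Bp by rewrite (O4 QP isT) (O3 QP isT).
have H6 := @does_stream S QFam (fun a => [:: (QOut, a)]) 1 _ [::] s5 (end_enc_family _) M5.
rewrite emitted_copy [behead _]/= in H6.
set s6 := upd _ _ _ in H6.
have P6 : s6 QP = enc_family Bp ++ [::] by rewrite cats0 -P5.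
have H7 := @does_stream S QP emit_extended 2 _ [::] s6 (end_enc_family _) P6.
rewrite emitted_extended [behead _]/= in H7.
set s7 := upd _ _ _ in H7.
exists s7; split.
- eapply does_le.
    eapply does_bind; first exact: does_parse.
    eapply does_bind; first exact: H2.
    eapply does_bind; first exact: H3.
    eapply does_bind; first exact: H4.
    eapply does_bind; first exact: does_enq.
    eapply does_bind; first by apply: H6.
    by apply: H7 => // a; rewrite /emit_extended; case: ifP.
  rewrite !size_family size_map size_enum_ord.
  (* The separators give each implication and each set length at least one, so the input length
     bounds all loop counts, even for [n = 0]. *)
  have sw : size w = n + (1 + (size Sigma * (n + n + 1) + (1 + (size Bp * (n + 1) + (1 + size Bm * (n + 1)))))).
    rewrite /w /enc_DUAL !size_cat size_nseq /= !size_family.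
    by rewrite (size_blocks _ (@size_enc_imp n)).
  have ln : n <= size w by rewrite sw; lia.
  have lS : size Sigma <= size w by rewrite sw; nia.
  have lP : size Bp * (n + 1) <= size w by rewrite sw; nia.
  have lB : size Bm <= size w by rewrite sw; nia.
  have lc := process_cost_le ln lS.
  move: lc ln lP lB; rewrite -/w /reduce_cost; clear; move: (size w) (process_cost (size w) (size w)) (process_cost n (size Sigma)) (size Bp * (n + 1)) (size Bm) => N C c p b.
  move=> lc ln lp lb.
  have l1 : n * (c + 4) <= N * (C + 4) by rewrite leq_mul // leq_add2r.
  have l2 : b * (n * 24 + 22) <= N * (N * 24 + 22) by rewrite leq_mul // leq_add2r leq_mul2r ln orbT.
  have l3 : n * (n + 1) <= N * (N + 1) by rewrite leq_mul // leq_add2r.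
  by nia.
- have -> : s7 QOut = (rcons (s4 QOut) LEnd ++
      enc_family [seq ord_max |: lift_set (~: anc Sigma y) | y <- enum 'I_n]) ++
      enc_family [seq lift_set B | B <- Bp] by [].
  rewrite U4 /enc_CMI /cmi_base /cmi_family enc_base_cat enc_family_cat -cats1.
  by rewrite -!catA.
Qed.

End ReductionProgram.

(** * Closure of polynomial bounds, and the final running time *)

Definition polynomial (f : nat -> nat) : Prop :=
  exists c k, forall x, f x <= c * x.+1 ^ k.

Lemma polynomial_const a : polynomial (fun=> a).
Proof. by exists a, 0 => x; rewrite expn0 muln1. Qed.

Lemma polynomial_id : polynomial id.
Proof. by exists 1, 1 => x; rewrite mul1n expn1. Qed.

(** The base [x.+1] is positive, so both exponents can be raised to their sum. *)
Lemma polynomial_add f g : polynomial f -> polynomial g -> polynomial (fun x => f x + g x).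
Proof.
move=> [c [k Hf]] [d [l Hg]]; exists (c + d), (k + l) => x.
rewrite mulnDl leq_add //.
  by apply: leq_trans (Hf x) _; rewrite leq_mul2l leq_pexp2l ?leq_addr ?orbT.
by apply: leq_trans (Hg x) _; rewrite leq_mul2l leq_pexp2l ?leq_addl ?orbT.
Qed.

Lemma polynomial_mul f g : polynomial f -> polynomial g -> polynomial (fun x => f x * g x).
Proof.
move=> [c [k Hf]] [d [l Hg]]; exists (c * d), (k + l) => x.
by rewrite expnD mulnACA leq_mul.
Qed.

Lemma polynomial_exp f k : polynomial f -> polynomial (fun x => f x ^ k).
Proof.
move=> Hf; elim: k => [|k IH]; first exact: (polynomial_const 1).
have [c [l H]] := polynomial_mul Hf IH.
by exists c, l => x; rewrite expnS.
Qed.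

(** For positive [x] one has x + 1 <= 2x, whence the factor [2 ^ k]; the additive constant covers
    [x = 0]. *)
Lemma polynomial_bound f : polynomial f -> exists c k, forall x, f x <= c * x ^ k + c.
Proof.
move=> [c [k H]]; exists (c * 2 ^ k), k => x; apply: leq_trans (H x) _.
case: x {H} => [|x]; first by rewrite exp1n muln1 (leq_trans _ (leq_addl _ _)) // leq_pmulr ?expn_gt0.
apply: leq_trans (leq_addr _ _); rewrite -mulnA leq_mul2l -expnMn; apply/orP; right.
by case: k => [|k] //; rewrite leq_exp2r //; lia.
Qed.

Theorem theorem1 : CMI_acyclic_in_P -> DUAL_distributive_in_P.
Proof.
case=> M [c [k HM]].
(* This is the bound of [simulate] with the running time of [M] taken at [N + T], the largest
   possible length of the produced instance. *)
pose time N := let T := reduce_cost N in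
  T * (2 * (N + T) + 8) + (N + T) + 4 + (c * (N + T) ^ k + c).
have [d [l Hd]] : exists d l, forall N, time N <= d * N ^ l + d.
  apply: polynomial_bound; rewrite /time /reduce_cost /process_cost.
  by repeat first [apply: polynomial_add | apply: polynomial_mul | apply: polynomial_exp
    | exact: polynomial_const | exact: polynomial_id].
exists (machine_of (bind (open_tape M) (fun=> bind reduce (fun=> seek_output M)))), d, l.
move=> n Sigma Bp Bm U aBp aBm; cbv zeta; set w := enc_DUAL _ _ _.
rewrite -(reduction_correct U aBp aBm).
have [s [Hs Es]] := @does_reduce (tm_sym M) n Sigma Bp Bm.
have H := HM _ _ (cmi_family Sigma Bp) (@cmi_base_acyclic n Sigma Bm).
cbv zeta in H; rewrite -Es in H.
apply: (simulate _ Hs H); first by rewrite /w /enc_DUAL; case: (nseq n L1).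
apply: leq_trans (Hd _); rewrite /time leq_add2l leq_add2r leq_mul2l.
(* The case [k = 0] is separate because the power is then constant. *)
apply/orP; right; have := output_size QOut Hs; rewrite -/w.
by case: (k) => [|j] // H1; rewrite leq_exp2r.
Qed.
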